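(* Let $X_1,\ldots,X_n$ be i.i.d. from $P_\theta$, where the scalar-parameter model $\{P_\theta\}$ is differentiable in quadratic mean at $\theta=0$ with Fisher information $I_0$ at $0$ satisfying $0<I_0<\infty$. Let $\Delta_n>0$ be a sequence such that $$\lambda_n=\sqrt{nI_0}\,\Delta_n\longrightarrow\kappa\in[0,\infty).$$ For $\varepsilon\in(0,1)$ let $$\mathcal N_n(\varepsilon)=\{\theta:|\theta|\le(1-\varepsilon)\Delta_n\},\qquad \mathcal M_n(\varepsilon)=\{\theta:|\theta|\ge(1+\varepsilon)\Delta_n\},$$ and let $$R_n^*=\inf_{\phi_n}\Big\{\sup_{\theta\in\mathcal N_n(\varepsilon)}E_\theta\phi_n+\sup_{\theta\in\mathcal M_n(\varepsilon)}E_\theta(1-\phi_n)\Big\},$$ where the infimum is over all measurable functions $\phi_n=\phi_n(X_1,\ldots,X_n)$ with values in $[0,1]$. Then, for every fixed $\varepsilon\in(0,1)$, $$\liminf_{n\to\infty}R_n^*\ge 2\{1-\Phi(\varepsilon\kappa)\}.$$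
   Context: $\Phi$ is the standard normal distribution function. The model $\{P_\theta\}$ is indexed by a real parameter set containing a neighborhood of $0$; the sets $\mathcal N_n(\varepsilon)$, $\mathcal M_n(\varepsilon)$ are subsets of that parameter set. $E_\theta$ denotes expectation when $X_1,\ldots,X_n$ are i.i.d. $P_\theta$. Differentiability in quadratic mean at $0$: with densities $p_\theta$ with respect to dominating measures, there is a score function $\dot\ell$ with $\int(\sqrt{p_h}-\sqrt{p_0}-\tfrac12 h\dot\ell\sqrt{p_0})^2=o(h^2)$ as $h\to0$, and $I_0=E_{P_0}\dot\ell^2$. *)

(* Defs.v *)
From HB Require Import structures.
From mathcomp Require Import all_boot all_order all_algebra.
From mathcomp Require Import all_classical all_reals all_analysis.

Set Implicit Arguments.
Unset Strict Implicit.
Unset Printing Implicit Defensive.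

Import Order.TTheory GRing.Theory Num.Theory.
Import numFieldNormedType.Exports.

Local Open Scope classical_set_scope.
Local Open Scope ring_scope.

Definition Phi (R : realType) (x : R) : R :=
  fine (normal_prob (0 : R) 1 `]-oo, x]).

Section iid_law.
Context (d : measure_display) (T : measurableType d) (R : realType).

Definition cons_pair n (x : T * n.-tuple T) : n.+1.-tuple T :=
  [the n.+1.-tuple T of x.1 :: x.2].

Lemma measurable_cons_pair n : measurable_fun [set: T * n.-tuple T] (@cons_pair n).
Proof. exact: measurable_cons. Qed.

HB.instance Definition _ n :=
  isMeasurableFun.Build _ _ _ _ (@cons_pair n) (@measurable_cons_pair n).

(* The law of (X_1, ..., X_n) for X_1, ..., X_n i.i.d. P, that is, the n-fold
   product of P; iid_law_box characterizes it. *)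
Fixpoint iid_law (P : probability T R) (n : nat) : probability (n.-tuple T) R :=
  match n with
  | 0 => dirac [tuple]
  | m.+1 => distribution (P \x iid_law P m)%E (@cons_pair m)
  end.

Lemma iid_law_box (P : probability T R) (n : nat) (A : 'I_n -> set T) :
  (forall i, measurable (A i)) ->
  iid_law P n [set x | forall i, A i (tnth x i)] = (\prod_(i < n) P (A i))%E.
Proof.
elim: n A => [|n IHn] A mA.
  by rewrite big_ord0 /= diracE mem_set//= => -[].
pose B := [set x : n.-tuple T | forall i, A (lift ord0 i) (tnth x i)].
have mB : measurable B.
  have -> : B = \bigcap_(i in [set: 'I_n])
      ((@tnth n T ^~ i) @^-1` A (lift ord0 i)).
    by apply/seteqP; split => x /= h i => [_|]; exact: h.
  apply: fin_bigcap_measurable => // i _.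
  by rewrite -[X in measurable X]setTI; exact: measurable_tnth.
rewrite big_ord_recl -(IHn (fun i => A (lift ord0 i)))// -product_measure1E//.
rewrite /= /distribution /pushforward; congr (product_measure1 _ _ _).
apply/seteqP; split => [[x t]/= h|[x t]/= [Ax Bt] i].
  split=> [|i]; first by have := h ord0; rewrite /cons_pair tnth0.
  by have := h (lift ord0 i); rewrite /cons_pair tnthS.
by case: (unliftP ord0 i) => [j|] ->; rewrite /cons_pair ?tnthS ?tnth0.
Qed.

End iid_law.

Section dqm.
Context (d : measure_display) (T : measurableType d) (R : realType).

Definition is_density (Q : probability T R)
    (mu : {sigma_finite_measure set T -> \bar R}) (p : T -> R) : Prop :=
  [/\ measurable_fun setT p, (forall x, 0 <= p x) &
      forall A, measurable A -> Q A = (\int[mu]_(x in A) (p x)%:E)%E].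

(* The dominating measure mu h is allowed to depend on h, hence so is the
   density p0 h of P 0; the integral does not depend on these choices. It is
   compared in \bar R, so that its finiteness is part of the condition. *)
Definition dqm_at0 (Theta : set R) (P : R -> probability T R)
    (score : T -> R) : Prop :=
  measurable_fun setT score /\
  exists (mu : R -> {sigma_finite_measure set T -> \bar R})
         (p0 p : R -> T -> R),
    (forall h, Theta h ->
      is_density (P 0) (mu h) (p0 h) /\ is_density (P h) (mu h) (p h)) /\
    (forall e : R, 0 < e -> \forall h \near (0 : R), Theta h ->
      (\int[mu h]_x ((Num.sqrt (p h x) - Num.sqrt (p0 h x)
          - 2^-1 * h * score x * Num.sqrt (p0 h x)) ^+ 2)%:E
        <= (e * h ^+ 2)%:E)%E).

Definition fisher_information (P0 : probability T R) (score : T -> R) : \bar R :=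
  ('E_P0[fun x => (score x ^+ 2)%R])%E.

End dqm.

Section minimax_risk.
Context (d : measure_display) (T : measurableType d) (R : realType).
Variables (Theta : set R) (P : R -> probability T R).

Definition null_set (Delta eps : R) : set R :=
  Theta `&` [set theta | `|theta| <= (1 - eps) * Delta].

Definition alt_set (Delta eps : R) : set R :=
  Theta `&` [set theta | (1 + eps) * Delta <= `|theta|].

Definition is_test (n : nat) (phi : n.-tuple T -> R) : Prop :=
  measurable_fun setT phi /\ forall x, 0 <= phi x <= 1.

(* ereal_sup set0 = -oo; when Theta is a neighborhood of 0, alt_set is nonempty
   for all small enough Delta. *)
Definition risk (n : nat) (Delta eps : R) (phi : n.-tuple T -> R) : \bar R :=
  (ereal_sup ((fun theta => 'E_(iid_law (P theta) n)[phi]) @` null_set Delta eps)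
   + ereal_sup ((fun theta => 'E_(iid_law (P theta) n)[fun x => (1 - phi x)%R])
       @` alt_set Delta eps))%E.

Definition minimax_risk (n : nat) (Delta eps : R) : \bar R :=
  ereal_inf (@risk n Delta eps @` [set phi | is_test phi]).

End minimax_risk.

(* Main.v *)
(* Only the two parameters (1 - eps) Delta_n and (1 + eps) Delta_n matter. For
   positive weights u, v let W_s(u, v) be the Bayes risk
   min_phi (u E_0 phi + v E_s (1 - phi)) for testing N(0, 1) against N(s, 1); it
   is given by a Black-Scholes formula, and W_s(1, 1) = 2 (1 - Phi(s / 2)).
   By induction on the sample size n (conditioning on the first observation
   multiplies the weights by the likelihoods of that observation) the weighted
   risk of any test based on n observations is at least W_(s_n)(u, v), with
   s_n^2 = s_0^2 + n tau and tau = (2 eps Delta)^2 I0, up to an error that is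
   n o(Delta^2) (u + v). In one step, W_s is expanded to the second order in the
   square roots of the likelihood ratios with respect to P_0: differentiability
   in quadratic mean controls exactly these, and the second order term is matched
   by the derivative of W_s with respect to s^2 (a heat equation). The induction
   starts at a small s_0 > 0, where the expansions are uniform in (u, v), because
   W_s <= min(u, v). No central limit theorem and no contiguity is needed. *)
Require Import Defs.
From HB Require Import structures.
From mathcomp Require Import all_boot all_order all_algebra.
From mathcomp Require Import all_classical all_reals all_analysis.
From mathcomp Require Import measurable_realfun.
From mathcomp Require Import ring lra.

Set Implicit Arguments.
Unset Strict Implicit.
Unset Printing Implicit Defensive.

Import Order.TTheory GRing.Theory Num.Theory.
Import numFieldNormedType.Exports.

Local Open Scope classical_set_scope.
Local Open Scope ring_scope.

(** * The Bayes risk in the Gaussian shift experiment *)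

Section gaussian.
Context {R : realType}.
Implicit Types s x y z r rho tau : R.

Definition phi x : R := normal_pdf 0 1 x.
Definition ccdfn x : R := 1 - Phi x.

Lemma phiE x : phi x = normal_peak 1 * expR (- x ^+ 2 / 2).
Proof.
by rewrite /phi normal_pdfE ?oner_neq0// /normal_fun subr0 expr1n.
Qed.

Lemma phi_ge0 x : 0 <= phi x. Proof. exact: normal_pdf_ge0. Qed.

Lemma normal_peak1_le1 : normal_peak (1 : R) <= 1.
Proof.
have pi2 : 1 <= pi *+ 2 :> R by have := pi_ge2 R; rewrite mulr2n; lra.
rewrite /normal_peak expr1n mul1r invf_le1; last first.
  by rewrite sqrtr_gt0 (lt_le_trans ltr01).
by rewrite -[leLHS]sqrtr1; exact: ler_wsqrtr.
Qed.

Lemma phi_le1 x : phi x <= 1.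
Proof.
apply: le_trans normal_peak1_le1; apply: normal_pdf_ub; exact: oner_neq0.
Qed.

Lemma is_derive_phi x : is_derive x 1 phi (- x * phi x).
Proof.
have -> : phi = (fun x => normal_peak 1 * expR (- x ^+ 2 / 2)).
  by apply/funext => y; rewrite phiE.
by apply: is_derive_eq; rewrite /GRing.scale/= !mulr1; field.
Qed.

(** It follows from [|x| <= 1 + x ^+ 2 / 2 <= expR (x ^+ 2 / 2)], and it bounds the derivative of
    [phi]. *)
Lemma normr_mul_phi_le1 x : `|x * phi x| <= 1.
Proof.
rewrite normrM (ger0_norm (phi_ge0 x)) phiE mulrCA.
apply: (@le_trans _ _ (1 * (`|x| * expR (- x ^+ 2 / 2)))).
  by apply: ler_wpM2r; [rewrite mulr_ge0// expR_ge0|exact: normal_peak1_le1].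
rewrite mul1r mulNr expRN ler_pdivrMr ?expR_gt0// mul1r.
apply: le_trans (expR_ge1Dx _).
have := sqr_ge0 (`|x| - 1); rewrite -[x ^+ 2]real_normK ?num_real//.
nra.
Qed.



Lemma is_derive_Phi x : is_derive x 1 (@Phi R) (phi x).
Proof.
(* The right end [x + 1] makes [x] an interior point of the interval of integration. *)
have fi : lebesgue_measure.-integrable `]-oo, x + 1]
    (EFin \o normal_pdf (0 : R) 1).
  by apply: integrableS (integrable_normal_pdf 0 1).
have cx : {for x, continuous (normal_pdf (0 : R) 1)}.
  by apply: continuous_normal_pdf; exact: oner_neq0.
have [dF dFE] := continuous_FTC1 (ltr_pwDr ltr01 (lexx x)) fi (ltNyr x) cx.
by move: dF => /derivableP; rewrite -derive1E dFE.
Qed.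

Lemma is_derive_ccdfn x : is_derive x 1 ccdfn (- phi x).
Proof.
have h := is_deriveB (is_derive_cst (1 : R) x 1) (is_derive_Phi x).
by rewrite sub0r in h.
Qed.

Lemma Phi_ge0 x : 0 <= Phi x.
Proof. by rewrite fine_ge0. Qed.

Lemma Phi_le1 x : Phi x <= 1.
Proof.
by rewrite -lee_fin fineK ?fin_num_measure//; exact: probability_le1.
Qed.

Lemma ccdfn_ge0 x : 0 <= ccdfn x.
Proof. by rewrite subr_ge0 Phi_le1. Qed.

Lemma ccdfn_le1 x : ccdfn x <= 1.
Proof. by rewrite gerBl Phi_ge0. Qed.

(** Under [normal_prob 0 1] the identity is a random variable with distribution function [Phi],
    which gives the limit of [Phi] at infinity. *)
Let idTR : measurableTypeR R -> R := idfun.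

#[local] HB.instance Definition _ :=
  @isMeasurableFun.Build _ _ _ _ idTR (@measurable_id _ _ setT).

Lemma cvg_ccdfn : ccdfn x @[x --> +oo] --> 0.
Proof.
rewrite -(subrr 1); apply: cvgB; first exact: cvg_cst.
apply: (@fine_cvg _ _ _ _ (fun x => normal_prob 0 1 `]-oo, x])).
exact: (@cvg_cdfy1 _ _ R (normal_prob 0 1) idTR).
Qed.

(** Running through the segment with a parameter [t] in [0, 1] avoids assuming [a <= b]; log-ratios
    of either sign occur below. *)
Lemma MVT_line (f df : R -> R) (a b : R) :
  (forall t : R, 0 <= t <= 1 ->
    is_derive (a + t * (b - a)) 1 f (df (a + t * (b - a)))) ->
  exists2 t : R, 0 <= t <= 1 & f b - f a = df (a + t * (b - a)) * (b - a).
Proof.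
move=> fd; pose l (t : R) := a + t * (b - a).
have ld (t : R) : is_derive t 1 l (b - a).
  by apply: is_derive_eq; rewrite /GRing.scale/=; ring.
have hd (t : R) : 0 <= t <= 1 -> is_derive t 1 (f \o l) (df (l t) * (b - a)).
  by move=> /fd ?; exact: is_derive1_comp.
have [|t||t t01] := @MVT_segment R (f \o l) (fun t => df (l t) * (b - a)) 0 1.
- exact: ler01.
- by rewrite in_itv/= => /andP[t0 t1]; apply: hd; rewrite !ltW.
- apply: derivable_within_continuous => t; rewrite in_itv/= => /hd h.
  exact: ex_derive.
- rewrite /l/= mul1r mul0r addr0 subrKC subr0 mulr1 => ->.
  by exists t => //; move: t01; rewrite in_itv.
Qed.

(** The squares of [s / 2 + x / s] and [s / 2 - x / s] differ by [2 * x]. This identity combines the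
    density terms in both derivatives of [gauss_risk1]. *)
Lemma expR_mul_phi s x : s != 0 -> expR x * phi (s / 2 + x / s) = phi (s / 2 - x / s).
Proof.
move=> s0; rewrite !phiE mulrCA -expRD; congr (_ * expR _); field.
exact: s0.
Qed.

Lemma is_derive_ccdfn_comp (g : R -> R) (x b : R) :
  is_derive x 1 g b -> is_derive x 1 (fun y => ccdfn (g y)) (- phi (g x) * b).
Proof. exact: is_derive1_comp (is_derive_ccdfn _). Qed.

Lemma is_derive_phi_comp (g : R -> R) (x b : R) :
  is_derive x 1 g b -> is_derive x 1 (fun y => phi (g y)) (- g x * phi (g x) * b).
Proof. exact: is_derive1_comp (is_derive_phi _). Qed.

(* W_s(exp x, 1) *)
Definition gauss_risk1 s x := expR x * ccdfn (s / 2 + x / s) + ccdfn (s / 2 - x / s).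

(* Minus the second derivative of W_s(r, 1) in r, times r ^ 2, at r = exp x. *)
Definition gauss_gamma s x := phi (s / 2 - x / s) / s.

(** By [expR_mul_phi] the two density terms cancel, as for the Black-Scholes delta. *)
Lemma is_derive_gauss_risk1 s x : s != 0 ->
  is_derive x 1 (gauss_risk1 s) (expR x * ccdfn (s / 2 + x / s)).
Proof.
move=> s0.
have d1 : is_derive x 1 (fun y => s / 2 + y / s) s^-1.
  by apply: is_derive_eq; rewrite /GRing.scale/=; field.
have d2 : is_derive x 1 (fun y => s / 2 - y / s) (- s^-1).
  by apply: is_derive_eq; rewrite /GRing.scale/=; field.
have h1 := is_derive_ccdfn_comp d1.
have h2 := is_derive_ccdfn_comp d2.
apply: is_derive_eq; rewrite /GRing.scale/= -(expR_mul_phi x s0); field.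
exact: s0.
Qed.

(** By [expR_mul_phi] the terms with [x * s ^- 2] cancel and the two halves of the density add up;
    this is the Black-Scholes vega up to sign. *)
Lemma is_derive_gauss_risk1_s s x : s != 0 ->
  is_derive s 1 (fun s => gauss_risk1 s x) (- phi (s / 2 - x / s)).
Proof.
move=> s0.
have d0 : is_derive s 1 (fun s : R => s^-1) (- s ^- 2).
  by apply: is_derive_eq; [exact: is_deriveV|rewrite /GRing.scale/= mulr1].
have d1 : is_derive s 1 (fun s => s / 2 + x / s) (2^-1 - x * s ^- 2).
  by apply: is_derive_eq; rewrite /GRing.scale/=; field.
have d2 : is_derive s 1 (fun s => s / 2 - x / s) (2^-1 + x * s ^- 2).
  by apply: is_derive_eq; rewrite /GRing.scale/=; field.
have h1 := is_derive_ccdfn_comp d1.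
have h2 := is_derive_ccdfn_comp d2.
apply: is_derive_eq; rewrite /GRing.scale/= -(expR_mul_phi x s0); field.
exact: s0.
Qed.

(* The left-hand side is (1 - W_s(exp x, 1)) / exp x; it is nonincreasing in x and
   its limit at +oo is nonnegative. *)
Lemma gauss_risk1_gap_ge0 s x : 0 < s ->
  0 <= expR (- x) * Phi (s / 2 - x / s) - ccdfn (s / 2 + x / s).
Proof.
move=> s_gt0; have s0 : s != 0 by rewrite gt_eqF.
pose H y := expR (- y) * Phi (s / 2 - y / s) - ccdfn (s / 2 + y / s).
have Hd y : is_derive y 1 H (- (expR (- y) * Phi (s / 2 - y / s))).
  have d1 : is_derive y 1 (fun y => s / 2 + y / s) s^-1.
    by apply: is_derive_eq; rewrite /GRing.scale/=; field.
  have d2 : is_derive y 1 (fun y => s / 2 - y / s) (- s^-1).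
    by apply: is_derive_eq; rewrite /GRing.scale/=; field.
  have h1 := is_derive_ccdfn_comp d1.
  have h2 : is_derive y 1 (fun y => Phi (s / 2 - y / s))
      (phi (s / 2 - y / s) * - s^-1).
    exact: is_derive1_comp (is_derive_Phi _) d2.
  have h3 : is_derive y 1 (fun y : R => expR (- y)) (- expR (- y)).
    by apply: is_derive_eq; rewrite /GRing.scale/= mulrN1.
  apply: is_derive_eq; rewrite /GRing.scale/= -(expR_mul_phi y s0) mulrA.
  by rewrite expRxMexpNx_1 || (rewrite mulrA -expRD addNr expR0 mul1r); field.
have Hnincr y : x <= y -> - ccdfn (s / 2 + y / s) <= H x.
  move=> xy; have [t t01 HE] :=
    @MVT_line H (fun y => - (expR (- y) * Phi (s / 2 - y / s))) x y
    (fun t _ => Hd (x + t * (y - x))).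
  apply: (@le_trans _ _ (H y)).
    by rewrite lerDr mulr_ge0 ?expR_ge0 ?Phi_ge0.
  rewrite -subr_le0 HE mulNr oppr_le0.
  by rewrite !mulr_ge0 ?expR_ge0 ?Phi_ge0// subr_ge0.
apply/ler_addgt0Pr => e e0.
have /cvgrPdist_lt/(_ e e0)[M [_ HM]] := cvg_ccdfn.
(* The second entry forces [M < s / 2 + y / s], so that [ccdfn] is below [e] there. *)
pose y := Num.max x (s * (M + 1)).
apply: le_trans (lerD (Hnincr y _) (lexx e)); last by rewrite le_max lexx.
have /HM : M < s / 2 + y / s.
  rewrite ltr_wpDl ?divr_ge0// ?(ltW s_gt0)// ltr_pdivlMr// lt_max.
  by rewrite [_ * s]mulrC ltr_pM2l// ltrDl ltr01 orbT.
by rewrite sub0r normrN ger0_norm ?ccdfn_ge0// => /ltW ?; lra.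
Qed.

Lemma gauss_risk1_le1 s x : 0 < s -> gauss_risk1 s x <= 1.
Proof.
move=> s0; have := gauss_risk1_gap_ge0 x s0; rewrite -(pmulr_rge0 _ (expR_gt0 x)).
rewrite mulrBr mulrA -expRD subrr expR0 mul1r /gauss_risk1 /ccdfn.
lra.
Qed.

(** Exchanging the two hypotheses replaces [x] by [- x] in the gap inequality. *)
Lemma gauss_risk1_le_expR s x : 0 < s -> gauss_risk1 s x <= expR x.
Proof.
move=> s0; have := gauss_risk1_gap_ge0 (- x) s0; rewrite opprK !mulNr opprK.
rewrite /gauss_risk1 /ccdfn; lra.
Qed.

(** This is a discrete step of the heat equation. The mean value theorem in [s] gives a decrease by
    a density times [s' - s], where [s' - s] is [tau / (2 * s)] up to order [tau ^+ 2] and the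
    density is at least [1 - tau / 8] times the one at [s]. *)
Lemma gauss_risk1_timestep s tau x : 0 < s -> 0 <= tau ->
  gauss_risk1 (Num.sqrt (s ^+ 2 + tau)) x <=
  gauss_risk1 s x - tau / 2 * gauss_gamma s x + (s ^- 3 + s^-1) * tau ^+ 2.
Proof.
move=> s_gt0 tau0; set s' := Num.sqrt _.
have s'2 : s' ^+ 2 = s ^+ 2 + tau.
  by rewrite sqr_sqrtr// addr_ge0// sqr_ge0.
have ss' : s <= s'.
  by rewrite -(@ler_pXn2r _ 2) ?nnegrE ?sqrtr_ge0 ?(ltW s_gt0)// s'2 lerDl.
have [|t /andP[t0 t1]] := @MVT_line (fun s => gauss_risk1 s x)
   (fun s => - phi (s / 2 - x / s)) s s'.
  move=> r /andP[r0 r1]; apply: is_derive_gauss_risk1_s; rewrite gt_eqF//.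
  by rewrite ltr_pwDl ?mulr_ge0 ?subr_ge0.
set xi := s + _ => KE.
have s_xi : s <= xi by rewrite lerDl mulr_ge0// subr_ge0.
have xi_s' : xi <= s'.
  by rewrite -lerBrDl ler_piMl// subr_ge0.
(* The exponent of [phi] is [- s ^+ 2 / 8 + x / 2 - x ^+ 2 / s ^+ 2 / 2]: passing to [xi] lowers the
   first term by at most [tau / 8] and does not lower the last one. *)
have phi_xi : phi (s / 2 - x / s) * (1 - tau / 8) <= phi (xi / 2 - x / xi).
  have xi_gt0 : 0 < xi by exact: lt_le_trans s_xi.
  apply: (@le_trans _ _ (phi (s / 2 - x / s) * expR (- tau / 8))).
    apply: ler_wpM2l; first exact: phi_ge0.
    by apply: le_trans (expR_ge1Dx _); rewrite mulNr.
  rewrite !phiE -mulrA -expRD ler_wpM2l ?normal_peak_ge0// ler_expR.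
  have xi2 : xi ^+ 2 <= s ^+ 2 + tau.
    rewrite -s'2; apply: ler_pM => //; exact: ltW.
  have sxi2 : s ^+ 2 <= xi ^+ 2.
    by apply: ler_pM => //; exact: ltW.
  have xxi : x ^+ 2 / xi ^+ 2 <= x ^+ 2 / s ^+ 2.
    by rewrite ler_wpM2l ?sqr_ge0// lef_pV2 ?posrE ?exprn_gt0.
  have -> : - (s / 2 - x / s) ^+ 2 / 2 =
     - s ^+ 2 / 8 + x / 2 - x ^+ 2 / s ^+ 2 / 2 by field; rewrite gt_eqF.
  have -> : - (xi / 2 - x / xi) ^+ 2 / 2 =
     - xi ^+ 2 / 8 + x / 2 - x ^+ 2 / xi ^+ 2 / 2 by field; rewrite gt_eqF.
  lra.
set p := phi (s / 2 - x / s) in phi_xi *.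
have p0 : 0 <= p by exact: phi_ge0.
have p1 : p <= 1 by exact: phi_le1.
pose D := s' - s.
have D0 : 0 <= D by rewrite subr_ge0.
have DE : D * (2 * s + D) = tau.
  have -> : D * (2 * s + D) = s' ^+ 2 - s ^+ 2 by rewrite /D; ring.
  by rewrite s'2 addrC addKr.
have Dup : D <= tau / (2 * s).
  by rewrite ler_pdivlMr ?mulr_gt0// -DE; nra.
(* From [D = tau / (2 * s) - D ^+ 2 / (2 * s)], with the upper bound [Dup] inserted in the
   square. *)
have Dlow : tau / (2 * s) - tau ^+ 2 / (8 * s ^+ 3) <= D.
  have -> : D = tau / (2 * s) - D ^+ 2 / (2 * s).
    by rewrite -DE; field; rewrite gt_eqF.
  rewrite lerD2l lerN2.
  have -> : tau ^+ 2 / (8 * s ^+ 3) = (tau / (2 * s)) ^+ 2 / (2 * s).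
    by field; rewrite gt_eqF.
  by rewrite ler_wpM2r ?invr_ge0 ?mulr_ge0 ?(ltW s_gt0)//; apply: ler_pM.
have step : p * (1 - tau / 8) * D <= phi (xi / 2 - x / xi) * D by rewrite ler_wpM2r.
have {KE} -> : gauss_risk1 s' x = gauss_risk1 s x - phi (xi / 2 - x / xi) * D.
  by rewrite /D -mulNr -KE; ring.
suff : p * (tau / (2 * s)) - (s ^- 3 + s^-1) * tau ^+ 2 <= p * (1 - tau / 8) * D.
  rewrite /gauss_gamma -/p => h.
  have -> : tau / 2 * (p / s) = p * (tau / (2 * s)) by field; rewrite gt_eqF.
  lra.
set A := tau / (2 * s) in Dup Dlow *.
set B := tau ^+ 2 / (8 * s ^+ 3) in Dlow.
have B0 : 0 <= B by rewrite divr_ge0 ?sqr_ge0// mulr_ge0// exprn_ge0// ltW.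
have -> : (s ^- 3 + s^-1) * tau ^+ 2 = 8 * B + 2 * (tau * A).
  by rewrite /A /B; field; rewrite gt_eqF.
have tA0 : 0 <= tau * A by rewrite mulr_ge0// divr_ge0// mulr_ge0// ltW.
have tD : tau * D <= tau * A by rewrite ler_wpM2l.
have : p * (A - B) <= p * D by rewrite ler_wpM2l.
have : p * (tau * D) <= tau * A.
  by apply: le_trans tD; rewrite ler_piMl ?mulr_ge0.
have : p * B <= B by rewrite ler_piMl.
nra.
Qed.

Lemma gauss_gamma_ge0 s x : 0 < s -> 0 <= gauss_gamma s x.
Proof. by move=> s0; rewrite divr_ge0 ?phi_ge0// ltW. Qed.

Lemma gauss_gamma_le s x : 0 < s -> gauss_gamma s x <= s^-1.
Proof.
by move=> s0; rewrite ler_pdivrMr// mulVf ?phi_le1// gt_eqF.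
Qed.

(** The derivative in [x] is [t * phi t / s ^+ 2] at [t = s / 2 - x / s], and [normr_mul_phi_le1]
    bounds it. *)
Lemma gauss_gamma_lipschitz s x y : 0 < s ->
  `|gauss_gamma s y - gauss_gamma s x| <= `|y - x| / s ^+ 2.
Proof.
move=> s0.
have [|t] := @MVT_line (gauss_gamma s)
   (fun x => (s / 2 - x / s) * phi (s / 2 - x / s) / s ^+ 2) x y.
  move=> t _; set z := x + _.
  have d2 : is_derive z 1 (fun y => s / 2 - y / s) (- s^-1).
    by apply: is_derive_eq; rewrite /GRing.scale/=; field; rewrite gt_eqF.
  have h2 := is_derive_phi_comp d2.
  by apply: is_derive_eq; rewrite /GRing.scale/=; field; rewrite gt_eqF.
move=> _ ->; rewrite normrM mulrC ler_wpM2l// normrM.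
rewrite [X in _ * X]ger0_norm ?invr_ge0 ?sqr_ge0//.
rewrite ler_piMl ?invr_ge0 ?sqr_ge0//; exact: normr_mul_phi_le1.
Qed.

(** Both signs of [r] reduce to [1 + x <= expR x]. The bound supplies the quadratic growth that
    outweighs the second-order term of the risk in [gauss_risk1_tangent]. *)
Lemma mulr_expR1_ge (r : R) : expR (- `|r|) * r ^+ 2 <= r * (1 - expR (- r)).
Proof.
have [r0|r0] := lerP 0 r.
  have : r <= expR r - 1 by rewrite lerBrDl expR_ge1Dx.
  move=> /(ler_wpM2l (mulr_ge0 r0 (expR_ge0 (- r)))).
  have E : expR (- r) * expR r = 1 by rewrite -expRD addNr expR0.
  have -> : r * expR (- r) * (expR r - 1) =
    r * (expR (- r) * expR r) - r * expR (- r) by ring.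
  by rewrite E expr2 ger0_norm//; lra.
have h : 1 - expR (- r) <= r by have := expR_ge1Dx (- r); lra.
have h1 : expR r <= 1 by rewrite expR_le1 ltW.
rewrite ltr0_norm// opprK.
have : r * r <= r * (1 - expR (- r)) by rewrite ler_nM2l.
have : expR r * r ^+ 2 <= r ^+ 2 by rewrite ler_piMl ?sqr_ge0.
rewrite expr2; lra.
Qed.

Lemma expR_le1D2x (r : R) : 0 <= r <= 1 / 2 -> expR r <= 1 + 2 * r.
Proof.
move=> /andP[r0 r1]; have := expR_ge1Dx (- r).
rewrite expRN => h.
have h2 : (1 - r) * expR r <= 1.
  by rewrite -ler_pdivlMr ?expR_gt0// mul1r.
have : 0 <= expR r by exact: expR_ge0.
nra.
Qed.

(** The left-hand side is the gap between the risk, concave in the likelihood ratio, and its tangent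
    at [expR x], taken at [expR (x + 2 * z)]; [expR z] will be a quotient of square roots of
    likelihood ratios. With [M] slightly above [2 * gauss_gamma s x], the function [g] is
    nonincreasing before 0 and nondecreasing after it within distance [rho], so [g 0 <= g z], which
    is the claim. *)
Lemma gauss_risk1_tangent s rho x z : 0 < s -> 0 <= rho <= 1 / 6 -> `|z| <= rho ->
  expR x * ccdfn (s / 2 + x / s) * expR (2 * z) + ccdfn (s / 2 - x / s)
    - gauss_risk1 s (x + 2 * z) <=
  (2 * gauss_gamma s x + 12 * rho * (s^-1 + s ^- 2)) * (expR z - 1) ^+ 2.
Proof.
move=> s0 /andP[rho0 rho1] zrho.
set M := 2 * gauss_gamma s x + _.
pose A y := ccdfn (s / 2 + y / s).
pose g r := M * (expR r - 1) ^+ 2 - expR x * A x * expR (2 * r)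
  + gauss_risk1 s (x + 2 * r).
pose dg r := 2 * expR r *
  (M * (expR r - 1) - expR r * (expR x * (A x - A (x + 2 * r)))).
have gd (r : R) : is_derive r 1 g (dg r).
  have d1 : is_derive r 1 (fun r => gauss_risk1 s (x + 2 * r))
      (expR (x + 2 * r) * A (x + 2 * r) * 2).
    apply: (@is_derive1_comp _ (gauss_risk1 s) (fun r => x + 2 * r)).
      by apply: is_derive_gauss_risk1; rewrite gt_eqF.
    by apply: is_derive_eq; rewrite /GRing.scale/=; ring.
  have d2 : is_derive r 1 (fun r : R => expR (2 * r)) (2 * (expR r * expR r)).
    apply: is_derive_eq; rewrite /GRing.scale/=.
    have -> : expR (2 * r) = expR r * expR r by rewrite -expRD; congr expR; ring.
    by ring.
  apply: is_derive_eq; rewrite /dg /GRing.scale/= expRD.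
  have -> : expR (2 * r) = expR r * expR r by rewrite -expRD; congr expR; ring.
  by ring.
have dgs (r : R) : `|r| <= rho -> 0 <= r * dg r.
  move=> rrho.
  have [|t /andP[t0 t1]] := @MVT_line A
    (fun y => - phi (s / 2 + y / s) / s) x (x + 2 * r).
    move=> t _; set y := x + _.
    have d1 : is_derive y 1 (fun y => s / 2 + y / s) s^-1.
      by apply: is_derive_eq; rewrite /GRing.scale/=; field; rewrite gt_eqF.
    exact: is_derive_ccdfn_comp.
  rewrite [x + 2 * r - x]addrAC subrr add0r; set y := x + t * _ => AE; rewrite /dg.
  have yE : y = x + t * (2 * r) by [].
  (* The mean value theorem and [expR_mul_phi] turn the change of [ccdfn] into [gauss_gamma] at the
     intermediate point [y]. *)
  have -> : expR x * (A x - A (x + 2 * r)) = expR (x - y) * gauss_gamma s y * (2 * r).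
    have -> : A x - A (x + 2 * r) = phi (s / 2 + y / s) / s * (2 * r).
      by rewrite -opprB AE; ring.
    rewrite /gauss_gamma -(@expR_mul_phi _ y) ?gt_eqF// expRD expRN.
    by field; rewrite !gt_eqF ?expR_gt0.
  have -> : x - y = - (t * (2 * r)) by rewrite yE; ring.
  have trrho : `|t * (2 * r)| <= 2 * rho.
    rewrite normrM (ger0_norm t0) normrM (@ger0_norm _ 2)//.
    apply: (@le_trans _ _ (1 * (2 * `|r|))); first by rewrite ler_wpM2r// mulr_ge0.
    by rewrite mul1r ler_pM2l.
  have -> : r * (2 * expR r * (M * (expR r - 1) -
       expR r * (expR (- (t * (2 * r))) * gauss_gamma s y * (2 * r)))) =
     2 * (expR r) ^+ 2 * (M * (r * (1 - expR (- r))) -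
       2 * (expR (- (t * (2 * r))) * gauss_gamma s y) * r ^+ 2).
    by rewrite (expRN r); field; rewrite gt_eqF ?expR_gt0.
  rewrite mulr_ge0 ?mulr_ge0 ?sqr_ge0// subr_ge0.
  have M0 : 0 <= M.
    have i1 : 0 <= s^-1 by rewrite invr_ge0 ltW.
    have i2 : 0 <= s ^- 2 by rewrite invr_ge0 sqr_ge0.
    apply: addr_ge0; first by rewrite mulr_ge0 ?gauss_gamma_ge0.
    by rewrite !mulr_ge0// addr_ge0.
  apply: le_trans (ler_wpM2l M0 (mulr_expR1_ge r)).
  rewrite [leRHS]mulrA ler_wpM2r ?sqr_ge0//.
  rewrite (expRN `|r|) ler_pdivlMr ?expR_gt0//.
  have k0 := gauss_gamma_ge0 y s0.
  have -> : 2 * (expR (- (t * (2 * r))) * gauss_gamma s y) * expR `|r| =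
    2 * (expR (- (t * (2 * r)) + `|r|) * gauss_gamma s y) by rewrite expRD; ring.
  have e3 : expR (- (t * (2 * r)) + `|r|) <= 1 + 6 * rho.
    apply: (@le_trans _ _ (expR (3 * rho))).
      rewrite ler_expR; have := ler_norm (- (t * (2 * r))); rewrite normrN; lra.
    by apply: le_trans (expR_le1D2x _) _; lra.
  have ky : gauss_gamma s y <= gauss_gamma s x + 2 * rho / s ^+ 2.
    have := le_trans (ler_norm _) (gauss_gamma_lipschitz x y s0).
    have : `|y - x| / s ^+ 2 <= 2 * rho / s ^+ 2.
      rewrite ler_wpM2r ?invr_ge0 ?sqr_ge0//.
      by rewrite yE addrAC subrr add0r.
    lra.
  have kx := gauss_gamma_le x s0.
  rewrite /M; move: ky kx e3 k0.
  have : 0 <= s ^- 2 by rewrite invr_ge0 sqr_ge0.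
  have : 0 <= gauss_gamma s x by exact: gauss_gamma_ge0.
  set E := expR _; set k := gauss_gamma s x; set k' := gauss_gamma s y.
  set i1 := s^-1; set i2 := s ^- 2 => k_ge0 i2_ge0 ky kx e3 k0.
  have h1 : E * k' <= (1 + 6 * rho) * k' by rewrite ler_wpM2r.
  have h2 : (1 + 6 * rho) * k' <= (1 + 6 * rho) * (k + 2 * rho * i2).
    by rewrite ler_wpM2l// addr_ge0// mulr_ge0.
  have h3 : rho * k <= rho * i1 by rewrite ler_wpM2l.
  have h4 : 0 <= rho * i2 by rewrite mulr_ge0.
  have h5 : rho * (rho * i2) <= 1 / 6 * (rho * i2) by rewrite ler_wpM2r.
  nra.
have g0 : g 0 = ccdfn (s / 2 - x / s).
  by rewrite /g !mulr0 expR0 subrr expr0n/= mulr0 mulr1 addr0 /gauss_risk1 /A; ring.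
have [t /andP[t0 t1]] := @MVT_line g dg 0 z (fun t _ => gd (0 + t * (z - 0))).
rewrite add0r subr0 g0 => gE.
(* The sign given by [dgs] concerns [t * z * dg (t * z)]; hence the multiplication by [t] and the
   separate case [t = 0], where [dg] vanishes. *)
suff : 0 <= dg (t * z) * z by rewrite -gE /g -/(A x); lra.
have [->|tn0] := eqVneq t 0.
  by rewrite mul0r /dg expR0 mulr0 addr0 !subrr !(mulr0, mul0r) subrr mulr0 mul0r.
have tp : 0 < t by rewrite lt_neqAle eq_sym tn0.
rewrite -(pmulr_rge0 _ tp).
have -> : t * (dg (t * z) * z) = t * z * dg (t * z) by ring.
rewrite dgs// normrM (ger0_norm t0) (le_trans _ zrho)// ler_piMl//.
Qed.

End gaussian.

(** * Second-order bounds in the likelihood ratios of one observation *)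

Section pointwise.
Context {R : realType}.
Implicit Types s u v x a b : R.

(* Homogeneity of degree 1 reduces W_s(u, v) to W_s(u / v, 1). *)
Definition gauss_risk s u v := v * gauss_risk1 s (ln (u / v)).

(** The two constant tests have weighted risks [u] and [v]. The bound starts the induction on the
    sample size. *)
Lemma gauss_risk_le_min s u v : 0 < s -> 0 < u -> 0 < v ->
  gauss_risk s u v <= Num.min u v.
Proof.
move=> s0 u0 v0; rewrite le_min /gauss_risk; apply/andP; split.
  rewrite -[leRHS](divfK (lt0r_neq0 v0)) [leRHS]mulrC ler_pM2l//.
  apply: le_trans (gauss_risk1_le_expR _ s0) _.
  by rewrite lnK// posrE divr_gt0.
by rewrite ler_piMr ?(ltW v0)// gauss_risk1_le1.
Qed.

(** This is [gauss_risk1_tangent] at [expR z = a / b], scaled by [v * b ^+ 2]; [|a / b - 1| <= eta]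
    yields [|z| <= 2 * eta], whence the constant 24. *)
Lemma gauss_risk_tangent s (L eta : R) u v a b : 0 < s -> s^-1 + s ^- 2 <= L ->
  0 < eta <= 1 / 12 -> 0 < u -> 0 < v -> 0 < b -> `|a - b| <= eta * b ->
  u * a ^+ 2 * ccdfn (s / 2 + ln (u / v) / s)
    + v * b ^+ 2 * ccdfn (s / 2 - ln (u / v) / s)
    - gauss_risk s (u * a ^+ 2) (v * b ^+ 2) <=
  v * (2 * gauss_gamma s (ln (u / v)) + 24 * eta * L) * (a - b) ^+ 2.
Proof.
move=> s0 hL /andP[eta0 eta1] u0 v0 b0 abeta.
set x := ln (u / v).
have a0 : 0 < a.
  have : - (eta * b) <= a - b by move: abeta; rewrite ler_norml => /andP[].
  nra.
have r0 : 0 < a / b by exact: divr_gt0.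
pose z := ln (a / b).
have ez : expR z = a / b by rewrite lnK// posrE.
have ex : expR x = u / v by rewrite lnK// posrE divr_gt0.
have c1 : `|a / b - 1| <= eta.
  by rewrite -[X in _ - X](divff (lt0r_neq0 b0)) -mulrBl normrM normfV
    (gtr0_norm b0) ler_pdivrMr.
have zeta : `|z| <= 2 * eta.
  move: c1; rewrite ler_norml => /andP[cl cr]; rewrite ler_norml; apply/andP; split.
    have h := expR_ge1Dx (- z).
    rewrite expRN ez in h.
    have h2 : (1 - z) * (a / b) <= 1.
      by rewrite -ler_pdivlMr// mul1r.
    nra.
  have h := expR_ge1Dx z; rewrite ez in h; lra.
have := @gauss_risk1_tangent _ s (2 * eta) x z s0 _ zeta.
have -> : 0 <= 2 * eta <= 1 / 6 by apply/andP; split; lra.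
move=> /(_ isT) h.
have -> : gauss_risk s (u * a ^+ 2) (v * b ^+ 2) =
    v * b ^+ 2 * gauss_risk1 s (x + 2 * z).
  rewrite /gauss_risk; congr (_ * gauss_risk1 _ _).
  have -> : u * a ^+ 2 / (v * b ^+ 2) = (u / v) * (a / b) ^+ 2.
    by field; rewrite !gt_eqF.
  rewrite lnM ?posrE ?exprn_gt0 ?divr_gt0// lnXn// mulr2n /x /z.
  ring.
have e2z : expR (2 * z) = (a / b) ^+ 2.
  by rewrite -ez expr2 -expRD; congr expR; ring.
rewrite e2z ex ez in h.
have vb : 0 <= v * b ^+ 2 by rewrite mulr_ge0 ?(ltW v0) ?sqr_ge0.
have {}h := ler_wpM2l vb h.
apply: (@le_trans _ _ (v * b ^+ 2 *
  ((2 * gauss_gamma s x + 12 * (2 * eta) * (s^-1 + s ^- 2))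
  * (a / b - 1) ^+ 2))).
  apply: le_trans _ h; rewrite le_eqVlt; apply/orP; left; apply/eqP.
  by field; rewrite !gt_eqF.
have -> : v * b ^+ 2 * ((2 * gauss_gamma s x + 12 * (2 * eta) * (s^-1 + s ^- 2))
    * (a / b - 1) ^+ 2) =
    v * (2 * gauss_gamma s x + 24 * eta * (s^-1 + s ^- 2)) * (a - b) ^+ 2.
  by field; rewrite !gt_eqF.
by rewrite ler_wpM2r ?sqr_ge0// ler_wpM2l ?(ltW v0)// lerD2l ler_wpM2l// mulr_ge0 ?ltW.
Qed.

Lemma ler_sqrD_weighted (eta p q : R) : 0 < eta ->
  (p + q) ^+ 2 <= (1 + eta) * p ^+ 2 + (1 + eta^-1) * q ^+ 2.
Proof.
move=> e0; rewrite -subr_ge0.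
have -> : (1 + eta) * p ^+ 2 + (1 + eta^-1) * q ^+ 2 - (p + q) ^+ 2 =
  eta * (p - q / eta) ^+ 2 by field; rewrite gt_eqF.
by rewrite mulr_ge0 ?sqr_ge0 ?ltW.
Qed.

Lemma sqrD_le2 (p q : R) : (p + q) ^+ 2 <= 2 * (p ^+ 2 + q ^+ 2).
Proof. by have := sqr_ge0 (p - q); rewrite !expr2; lra. Qed.

(** Away from the diagonal [(a - b) ^+ 2] controls [b ^+ 2] and, through [a = b + (a - b)], also
    [a ^+ 2]. *)
Lemma far_ratio_sq (eta a b : R) : 0 < eta <= 1 / 12 -> 0 <= b ->
  eta * b <= `|a - b| ->
  a ^+ 2 <= 4 / eta ^+ 2 * (a - b) ^+ 2 /\ b ^+ 2 <= 4 / eta ^+ 2 * (a - b) ^+ 2.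
Proof.
move=> /andP[eta0 eta1] b0 babs.
have b2 : b ^+ 2 <= (a - b) ^+ 2 / eta ^+ 2.
  rewrite ler_pdivlMr ?exprn_gt0// mulrC -exprMn -[leRHS]real_normK ?num_real//.
  by apply: ler_pM => //; rewrite mulr_ge0// ltW.
have ei12 : 12 <= eta^-1 by rewrite -div1r ler_pdivlMr//; lra.
have i21 : 1 <= eta ^- 2.
  by rewrite -exprVn -(expr1n _ 2); apply: ler_pM => //; lra.
have DD : (a - b) ^+ 2 <= (a - b) ^+ 2 / eta ^+ 2.
  by rewrite ler_peMr ?sqr_ge0.
have D0 : 0 <= (a - b) ^+ 2 by exact: sqr_ge0.
split; last by lra.
by have := sqrD_le2 b (a - b); rewrite subrKC; lra.
Qed.

(** If none of the three alternatives holds, [a] and [b] are within [3 * eta / 16] of 1, so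
    [1 / 2 <= b] and [|a - b| <= eta / 2 <= eta * b]. *)
Lemma far_ratio_large (eta M al be sc e1 e2 : R) :
  let a := 1 + al * sc + e1 in let b := 1 + be * sc + e2 in
  0 < eta <= 1 / 12 -> `|al| * M <= eta / 16 -> `|be| * M <= eta / 16 ->
  ~~ ((0 < b) && (`|a - b| <= eta * b)) ->
  [\/ M < `|sc|, eta / 8 <= `|e1| | eta / 8 <= `|e2|].
Proof.
move=> a b /andP[eta0 eta1] alM beM bad.
have [?|scM] := ltP M `|sc|; first by apply: Or31.
have [?|h1] := leP (eta / 8) `|e1|; first by apply: Or32.
have [?|h2] := leP (eta / 8) `|e2|; first by apply: Or33.
exfalso; move/negP: bad; apply.
have als : `|al * sc| <= eta / 16 by rewrite normrM (le_trans _ alM)// ler_wpM2l.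
have bes : `|be * sc| <= eta / 16 by rewrite normrM (le_trans _ beM)// ler_wpM2l.
move: h1 h2 als bes; rewrite !ltr_norml !ler_norml {scM alM beM}.
move=> /andP[h1 h1'] /andP[h2 h2'] /andP[h3 h3'] /andP[h4 h4'].
have bb : 1 / 2 <= b by rewrite /b; lra.
have eb : eta * (1 / 2) <= eta * b by rewrite ler_wpM2l// ltW.
have abE : a - b = al * sc - be * sc + (e1 - e2) by rewrite /a /b; ring.
apply/andP; split; first by lra.
by rewrite abE; apply/andP; split; lra.
Qed.

(** Where the ratio is far from 1, even the score term counts as an error: [w] covers it when the
    score exceeds [M]; otherwise it is at most [eta / 8] before squaring, hence below one of the
    remainders. *)
Lemma large_score_sq (eta M al be sc e1 e2 w : R) :
  0 < eta -> 0 <= w -> (M < `|sc| -> sc ^+ 2 <= w) ->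
  `|al| * M <= eta / 16 -> `|be| * M <= eta / 16 ->
  [\/ M < `|sc|, eta / 8 <= `|e1| | eta / 8 <= `|e2|] ->
  (al - be) ^+ 2 * sc ^+ 2 <= (al - be) ^+ 2 * w + e1 ^+ 2 + e2 ^+ 2.
Proof.
move=> eta0 w0 hw alM beM hlarge.
have d2w : 0 <= (al - be) ^+ 2 * w by rewrite mulr_ge0 ?sqr_ge0.
have e10 := sqr_ge0 e1; have e20 := sqr_ge0 e2.
have [/hw scw|scM] := ltP M `|sc|.
  have := ler_wpM2l (sqr_ge0 (al - be)) scw; lra.
have ds : `|(al - be) * sc| <= eta / 8.
  rewrite mulrBl (le_trans (ler_normB _ _))// !normrM.
  have : `|al| * `|sc| <= `|al| * M by rewrite ler_wpM2l.
  have : `|be| * `|sc| <= `|be| * M by rewrite ler_wpM2l.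
  lra.
have sqle (e : R) : eta / 8 <= `|e| -> (al - be) ^+ 2 * sc ^+ 2 <= e ^+ 2.
  move=> he; rewrite -exprMn -[leLHS]real_normK ?num_real//.
  rewrite -[leRHS]real_normK ?num_real//.
  by apply: ler_pM => //; exact: le_trans he.
case: hlarge => [|/sqle h|/sqle h]; [by rewrite ltNge scM|lra|lra].
Qed.

(** Only [2 * k * X] has to be exact; [k <= L] and [eta <= 1 / 12] push every other product into the
    error terms. *)
Lemma near_ratio_bound (k L eta X Z : R) : 0 <= k <= L -> 0 < eta <= 1 / 12 ->
  0 <= X -> 0 <= Z ->
  (2 * k + 24 * eta * L) * ((1 + eta) * X + 4 * eta^-1 * Z) <=
  2 * k * X + (50 * L * eta * X + (16 * L / eta + 24 / eta ^+ 2) * Z).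
Proof.
move=> /andP[k0 kL] /andP[eta0 eta1] X0 Z0.
have L0 : 0 <= L by exact: le_trans kL.
have ei0 : 0 < eta^-1 by rewrite invr_gt0.
have e2Z : 0 <= 24 / eta ^+ 2 * Z by rewrite mulr_ge0 ?divr_ge0 ?sqr_ge0.
have LX : 0 <= L * eta * X by rewrite !mulr_ge0 ?(ltW eta0).
have LeX : L * eta * X * eta <= L * eta * X * (1 / 12) by rewrite ler_wpM2l.
have kX : k * (eta * X) <= L * (eta * X) by rewrite ler_wpM2r// mulr_ge0// ltW.
have Zi : 0 <= eta^-1 * Z by rewrite mulr_ge0// ltW.
have kZ : k * (eta^-1 * Z) <= L * (eta^-1 * Z) by rewrite ler_wpM2r.
have eL : eta * L <= 1 / 12 * L by rewrite ler_wpM2r.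
have eLZ : eta * L * (eta^-1 * Z) <= 1 / 12 * L * (eta^-1 * Z) by rewrite ler_wpM2r.
have kX0 : 0 <= k * X by rewrite mulr_ge0.
have -> : (2 * k + 24 * eta * L) * ((1 + eta) * X + 4 * eta^-1 * Z) =
  2 * (k * X) + 2 * (k * (eta * X)) + 24 * (L * eta * X)
  + 24 * (L * eta * X * eta) + 8 * (k * (eta^-1 * Z))
  + 96 * (eta * L * (eta^-1 * Z)) by ring.
rewrite (mulrDl _ _ Z).
have -> : 16 * L / eta * Z = 16 * (L * (eta^-1 * Z)) by ring.
lra.
Qed.

(* [a] and [b] stand for the square roots of the likelihood ratios of one
   observation, with linear parts [al * sc] and [be * sc]. Where [a / b] is close
   to 1 the bound is gauss_risk_tangent; elsewhere the left-hand side is at most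
   [u * a ^+ 2 + v * b ^+ 2], which is absorbed by [w + e1 ^+ 2 + e2 ^+ 2] because
   the score or one of the remainders has to be large. *)
Lemma local_risk_pointwise s L u v (K F G eta M al be sc e1 e2 w : R) :
  let a := 1 + al * sc + e1 in let b := 1 + be * sc + e2 in
  0 < s -> s^-1 + s ^- 2 <= L -> 0 < u -> 0 < v -> 0 <= K -> 0 <= F -> 0 <= G ->
  (forall p q : R, 0 < p -> 0 < q ->
    gauss_risk s p q - K * (p + q) <= p * F + q * G) ->
  0 < eta <= 1 / 12 -> 0 <= a -> 0 <= b ->
  `|al| * M <= eta / 16 -> `|be| * M <= eta / 16 -> 0 <= w ->
  (M < `|sc| -> sc ^+ 2 <= w) ->
  u * a ^+ 2 * ccdfn (s / 2 + ln (u / v) / s)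
    + v * b ^+ 2 * ccdfn (s / 2 - ln (u / v) / s)
  <= (u * a ^+ 2) * F + (v * b ^+ 2) * G + K * (u * a ^+ 2 + v * b ^+ 2)
    + v * (2 * gauss_gamma s (ln (u / v))) * ((al - be) ^+ 2 * sc ^+ 2)
    + (u + v) * (50 * L * eta * ((al - be) ^+ 2 * sc ^+ 2)
       + (16 * L / eta + 24 / eta ^+ 2)
         * ((al - be) ^+ 2 * w + e1 ^+ 2 + e2 ^+ 2)).
Proof.
move=> a b s0 hL u0 v0 K0 F0 G0 HW heta a0 b0 alM beM w0 hw.
have [eta0 eta1] := andP heta.
set A := ccdfn (s / 2 + _); set B := ccdfn (s / 2 - _).
set k := gauss_gamma s _.
have k0 : 0 <= k by exact: gauss_gamma_ge0.
have kL : k <= L.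
  apply: le_trans (gauss_gamma_le _ s0) _; apply: le_trans hL.
  by rewrite lerDl invr_ge0 sqr_ge0.
have L0 : 0 <= L by exact: le_trans kL.
have abE : a - b = (al - be) * sc + (e1 - e2) by rewrite /a /b; ring.
have ei0 : 0 < eta^-1 by rewrite invr_gt0.
have ei12 : 12 <= eta^-1 by rewrite -div1r ler_pdivlMr//; lra.
have e12 : (e1 - e2) ^+ 2 <= 2 * (e1 ^+ 2 + e2 ^+ 2).
  by have := sqrD_le2 e1 (- e2); rewrite sqrrN.
have ua0 : 0 <= u * a ^+ 2 by rewrite mulr_ge0 ?sqr_ge0 ?ltW.
have vb0 : 0 <= v * b ^+ 2 by rewrite mulr_ge0 ?sqr_ge0 ?ltW.
have d2w : 0 <= (al - be) ^+ 2 * w by rewrite mulr_ge0 ?sqr_ge0.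
have X0 : 0 <= (al - be) ^+ 2 * sc ^+ 2 by rewrite mulr_ge0 ?sqr_ge0.
have Y0 : 0 <= e1 ^+ 2 + e2 ^+ 2 by rewrite addr_ge0 ?sqr_ge0.
have large := large_score_sq eta0 w0 hw alM beM.
have near_or_far := @far_ratio_large eta M al be sc e1 e2 heta alM beM.
rewrite -/a -/b in near_or_far.
have W := ler_sqrD_weighted ((al - be) * sc) (e1 - e2) eta0.
have W' := sqrD_le2 ((al - be) * sc) (e1 - e2).
rewrite -abE exprMn in W W'.
have YZ : e1 ^+ 2 + e2 ^+ 2 <= (al - be) ^+ 2 * w + e1 ^+ 2 + e2 ^+ 2.
  by rewrite -addrA lerDr.
have {large} large := fun h => large e1 e2 (near_or_far h).
move: X0 W W' YZ large {near_or_far d2w alM beM hw}.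
set X := (al - be) ^+ 2 * sc ^+ 2; set Z := _ + e1 ^+ 2 + e2 ^+ 2.
move: (e1 ^+ 2 + e2 ^+ 2) Y0 e12 => Y Y0 e12.
move: X Z => X Z X0 W W' YZ large; clear abE.
have Z0 : 0 <= Z by exact: le_trans YZ.
pose rest := 50 * L * eta * X + (16 * L / eta + 24 / eta ^+ 2) * Z.
rewrite -/rest.
have R1 : 0 <= 50 * L * eta * X by rewrite !mulr_ge0 ?(ltW eta0).
have R2 : 0 <= 16 * L / eta * Z by rewrite !mulr_ge0 ?(ltW ei0).
have R3 : 24 / eta ^+ 2 * Z <= rest by rewrite /rest (mulrDl _ _ Z); lra.
have [good|bad] := boolP ((0 < b) && (`|a - b| <= eta * b)).
  have {good} [bp abeta] := andP good.
  have ap : 0 < a.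
    have : - (eta * b) <= a - b by move: abeta; rewrite ler_norml => /andP[].
    have : eta * b <= 1 / 12 * b by rewrite ler_wpM2r.
    lra.
  have T := gauss_risk_tangent s0 hL heta u0 v0 bp abeta.
  have H := HW (u * a ^+ 2) (v * b ^+ 2) (mulr_gt0 u0 (exprn_gt0 2 ap))
    (mulr_gt0 v0 (exprn_gt0 2 bp)).
  rewrite -/A -/B -/k in T.
  have W2 : (a - b) ^+ 2 <= (1 + eta) * X + 4 * eta^-1 * Z.
    apply: le_trans W _; rewrite lerD2l.
    apply: (@le_trans _ _ ((1 + eta^-1) * (2 * Z))).
      by rewrite ler_wpM2l ?addr_ge0 ?(ltW ei0)//; lra.
    have : 1 * Z <= eta^-1 * Z by rewrite ler_wpM2r//; lra.
    lra.
  have P0 : 0 <= 2 * k + 24 * eta * L.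
    by apply: addr_ge0; apply: mulr_ge0 => //; rewrite mulr_ge0// ltW.
  have kL01 : 0 <= k <= L by rewrite k0.
  have Q := le_trans (ler_wpM2l P0 W2) (near_ratio_bound kL01 heta X0 Z0).
  have V := ler_wpM2l (ltW v0) Q; rewrite mulrA in V.
  have U : 0 <= u * rest.
    rewrite mulr_ge0 ?(ltW u0)//; apply: le_trans R3.
    by rewrite mulr_ge0 ?divr_ge0 ?sqr_ge0.
  have {}V := le_trans T V.
  move: V U H; rewrite -/rest (mulrDr v) (mulrDl u v rest).
  move: (u * a ^+ 2) (v * b ^+ 2) (v * rest) (u * rest) => p q vr ur V U H.
  have -> : v * (2 * k) * X = v * (2 * k * X) by ring.
  move: V H; move: (v * _) (gauss_risk _ _ _) (K * _) => z1 z2 z3 V H.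
  lra.
have AB : u * a ^+ 2 * A + v * b ^+ 2 * B <= u * a ^+ 2 + v * b ^+ 2.
  by rewrite lerD// ler_piMr ?ccdfn_le1.
apply: (le_trans AB).
have babs : eta * b <= `|a - b|.
  have [b1|b1] := ltP 0 b; first by move: bad; rewrite b1/= -ltNge => /ltW.
  by apply: le_trans (normr_ge0 _); rewrite pmulr_rle0.
have [a2 b2] := far_ratio_sq heta b0 babs.
have i20 : 0 <= 4 / eta ^+ 2 by rewrite divr_ge0 ?sqr_ge0.
have abZ : 4 / eta ^+ 2 * (a - b) ^+ 2 <= rest.
  apply: le_trans R3.
  (* Here [W'], [e12] and [large bad] give [(a - b) ^+ 2 <= 2 * X + 4 * Y <= 6 * Z], whence the
     constant 24. *)
  have -> : 24 / eta ^+ 2 * Z = 4 / eta ^+ 2 * (6 * Z) by ring.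
  rewrite ler_wpM2l//; have := large bad; lra.
have ha : u * a ^+ 2 <= u * rest by rewrite ler_wpM2l ?(ltW u0)// (le_trans a2).
have hb : v * b ^+ 2 <= v * rest by rewrite ler_wpM2l ?(ltW v0)// (le_trans b2).
apply: (le_trans (lerD ha hb)); rewrite -mulrDl lerDr.
have vk : 0 <= v * (2 * k) * X.
  by apply: mulr_ge0 => //; apply: mulr_ge0; [exact: ltW|exact: mulr_ge0].
apply: addr_ge0 => //; apply: addr_ge0; last by rewrite mulr_ge0// addr_ge0.
by apply: addr_ge0; exact: mulr_ge0.
Qed.

End pointwise.

(** * Densities and product laws *)

Section density.
Import HBNNSimple.
Context d (T : measurableType d) (R : realType).
Variables (Q : probability T R) (mu : {sigma_finite_measure set T -> \bar R}).
Variable p : T -> R.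
Hypothesis Qp : is_density Q mu p.

(** [is_density] is the case of indicators; linearity and monotone convergence along simple
    functions extend it. *)
Lemma ge0_integral_density (f : T -> R) : measurable_fun setT f ->
  (forall x, 0 <= f x) ->
  (\int[Q]_x (f x)%:E = \int[mu]_x (f x * p x)%:E)%E.
Proof.
case: Qp => mp p0 QE mf f0.
pose ef : T -> \bar R := EFin \o f.
have mEf : measurable_fun setT ef by exact/measurable_EFinP.
pose h := nnsfun_approx measurableT mEf.
have cvgh x : (EFin \o h n) x @[n --> \oo] --> ef x.
  by apply: cvg_nnsfun_approx => // y _; rewrite lee_fin.
transitivity (limn (fun n => \int[Q]_x (h n x)%:E)%E).
  rewrite -monotone_convergence//=.
  - by apply: eq_integral => x _; apply/esym/cvg_lim => //; exact: cvgh.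
  - by move=> n; exact/measurable_EFinP/measurable_funTS.
  - by move=> n x _; rewrite lee_fin.
  - by move=> x _ a b ab; rewrite lee_fin; exact/lefP/nd_nnsfun_approx.
have mhp n : measurable_fun setT (fun x => (h n x * p x)%:E).
  by apply/measurable_EFinP/measurable_funM => //; exact/measurable_funTS.
transitivity (limn (fun n => \int[mu]_x (h n x * p x)%:E)%E); last first.
  rewrite -monotone_convergence//=.
  - apply: eq_integral => x _; apply/cvg_lim => //.
    under eq_fun do rewrite EFinM.
    by rewrite EFinM; apply: cvgeZr => //; exact: cvgh.
  - by move=> n x _; rewrite lee_fin mulr_ge0.
  - move=> x _ a b ab; rewrite lee_fin ler_wpM2r//.
    exact/lefP/nd_nnsfun_approx.
apply: congr_lim; apply/funext => n /=.
have mi r : measurable (h n @^-1` [set r]).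
  by rewrite -[X in measurable X]setTI; exact: measurable_funP.
transitivity (\int[Q]_x (\sum_(y \in range (h n))
    (y * \1_(h n @^-1` [set y]) x)%:E))%E.
  by apply: eq_integral => x _; rewrite fimfunE -fsumEFin.
rewrite ge0_integral_fsum//; first last.
  by move=> r x _; exact: nnfun_muleindic_ge0.
  by move=> r; apply/measurable_EFinP/measurable_funM.
transitivity (\int[mu]_x (\sum_(y \in range (h n))
    (y * \1_(h n @^-1` [set y]) x * p x)%:E))%E; last first.
  apply: eq_integral => x _; rewrite fsumEFin//; congr EFin.
  by rewrite [in RHS]fimfunE mulr_fsuml.
rewrite ge0_integral_fsum//; first last.
  by move=> r x _; rewrite EFinM mule_ge0 ?lee_fin//; exact: nnfun_muleindic_ge0.
  by move=> r; apply/measurable_EFinP/measurable_funM => //; exact: measurable_funM.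
apply: eq_fsbigr => r /[!inE] -[y _ ry].
have r0 : 0 <= r by rewrite -ry.
under eq_integral do rewrite EFinM.
under [RHS]eq_integral do rewrite -mulrA EFinM.
rewrite !ge0_integralZl//.
- rewrite integral_indic// setIT; congr (_ * _)%E.
  apply: etrans (QE _ (mi r)) _; rewrite [LHS]integral_mkcond restrict_EFin.
  by apply: eq_integral => x _; rewrite /= patch_indic/= mulrC.
- by apply/measurable_EFinP/measurable_funM => //; exact: measurable_indic.
- by move=> x _; rewrite lee_fin mulr_ge0.
- by apply/measurable_EFinP; exact: measurable_indic.
Qed.

End density.

(** * Square roots of likelihood ratios under quadratic mean differentiability *)

Section dqm_root.
Context d (T : measurableType d) (R : realType).

(* [root] is the square root of the density of the part of [Ph] that is absolutely
   continuous with respect to [P0]; the last clause bounds the singular part. *)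
Definition dqm_root (P0 Ph : probability T R) (score : T -> R) (h c : R)
    (root : T -> R) : Prop :=
  [/\ measurable_fun setT root, forall x, 0 <= root x,
     forall f : T -> R, measurable_fun setT f -> (forall x, 0 <= f x) ->
       (\int[P0]_x (f x * root x ^+ 2)%:E <= \int[Ph]_x (f x)%:E)%E,
     (\int[P0]_x ((root x - 1 - 2^-1 * h * score x) ^+ 2)%:E <= c%:E)%E &
     (1 <= \int[P0]_x (root x ^+ 2)%:E + c%:E)%E].

Lemma dqm_root_of_density (P0 Ph : probability T R) (score : T -> R) (h c : R)
    (mu : {sigma_finite_measure set T -> \bar R}) (p0 p : T -> R) :
  measurable_fun setT score -> is_density P0 mu p0 -> is_density Ph mu p ->
  (\int[mu]_x ((Num.sqrt (p x) - Num.sqrt (p0 x)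
      - 2^-1 * h * score x * Num.sqrt (p0 x)) ^+ 2)%:E <= c%:E)%E ->
  exists root, dqm_root P0 Ph score h c root.
Proof.
move=> ms dP0 dPh hc.
have [mp0 p00 _] := dP0; have [mp p_ge0 _] := dPh.
(* Division by 0 gives 0, so [root] vanishes where [p0] does, that is, on the set carrying the
   singular part. *)
pose root x := Num.sqrt (p x / p0 x).
have mroot : measurable_fun setT root.
  apply: (measurableT_comp (continuous_measurable_fun (@sqrt_continuous R))).
  apply: measurable_funM => //.
  rewrite (_ : (fun _ => _) = (fun x => p0 x `^ (-1))).
    exact: measurableT_comp (measurable_powR _) mp0.
  by apply/funext => x; rewrite powR_inv1.
have root_ge0 x : 0 <= root x by exact: sqrtr_ge0.
have root2 x : 0 < p0 x -> root x ^+ 2 * p0 x = p x.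
  by move=> p0x; rewrite sqr_sqrtr ?divr_ge0// divfK// gt_eqF.
have roots x : 0 < p0 x -> root x * Num.sqrt (p0 x) = Num.sqrt (p x).
  by move=> p0x; rewrite -sqrtrM ?divr_ge0// divfK// gt_eqF.
have p0_cases x : p0 x = 0 \/ 0 < p0 x.
  by have := p00 x; rewrite le_eqVlt => /predU1P[->|]; [left|right].
have mf2 (f : T -> R) : measurable_fun setT f ->
    measurable_fun setT (fun x => f x ^+ 2).
  by move=> mf; exact: measurable_funX.
have mrem : measurable_fun setT (fun x => root x - 1 - 2^-1 * h * score x).
  by apply: measurable_funB; [exact: measurable_funB|exact: measurable_funM].
have msqrt (f : T -> R) : measurable_fun setT f ->
    measurable_fun setT (fun x => Num.sqrt (f x)).
  exact: (measurableT_comp (continuous_measurable_fun (@sqrt_continuous R))).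
have mrem' : measurable_fun setT (fun x => Num.sqrt (p x) - Num.sqrt (p0 x)
      - 2^-1 * h * score x * Num.sqrt (p0 x)).
  apply: measurable_funB; first by apply: measurable_funB; exact: msqrt.
  by apply: measurable_funM; [exact: measurable_funM|exact: msqrt].
exists root; split => //.
- move=> f mf f0.
  rewrite (ge0_integral_density dP0) ?(ge0_integral_density dPh)//; first last.
  + by move=> x; rewrite mulr_ge0 ?sqr_ge0.
  + by apply: measurable_funM => //; exact: mf2.
  apply: ge0_le_integral => //.
  + by move=> x _; rewrite lee_fin !mulr_ge0 ?sqr_ge0.
  + apply/measurable_EFinP; apply: measurable_funM => //.
    by apply: measurable_funM => //; exact: mf2.
  + by apply/measurable_EFinP; exact: measurable_funM.
  + move=> x _; rewrite lee_fin -mulrA ler_wpM2l//.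
    by have [->|/root2->//] := p0_cases x; rewrite mulr0.
- apply: le_trans hc; rewrite (ge0_integral_density dP0); first last.
  + by move=> x; exact: sqr_ge0.
  + exact: mf2.
  apply: ge0_le_integral => //.
  + by move=> x _; rewrite lee_fin mulr_ge0 ?sqr_ge0.
  + by apply/measurable_EFinP; apply: measurable_funM => //; exact: mf2.
  + by apply/measurable_EFinP; exact: mf2.
  + move=> x _; rewrite lee_fin.
    have [->|p0x] := p0_cases x; first by rewrite mulr0 sqr_ge0.
    rewrite -[X in _ * X <= _](sqr_sqrtr (p00 x)) -exprMn -(roots _ p0x).
    by rewrite le_eqVlt; apply/orP; left; apply/eqP; congr (_ ^+ 2); ring.
(* Where [p0] vanishes, the quadratic mean integrand is [p] itself, so the singular part has mass at
   most [c]. *)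
- rewrite -(@probability_setT _ _ _ Ph).
  have [_ _ ->] := dPh; last exact: measurableT.
  apply: le_trans (leeD2l _ hc).
  rewrite (ge0_integral_density dP0); first last.
  + by move=> x; exact: sqr_ge0.
  + exact: mf2.
  rewrite -ge0_integralD//.
  + apply: ge0_le_integral => //.
    * by move=> x _; rewrite lee_fin.
    * exact/measurable_EFinP.
    * apply: emeasurable_funD; apply/measurable_EFinP; last exact: mf2.
      by apply: measurable_funM => //; exact: mf2.
    * move=> x _; rewrite -EFinD lee_fin.
      have [p0x|p0x] := p0_cases x; last by rewrite root2// lerDl sqr_ge0.
      by rewrite p0x sqrtr0 !mulr0 !subr0 add0r sqr_sqrtr.
  + by move=> x _; rewrite lee_fin mulr_ge0 ?sqr_ge0.
  + by apply/measurable_EFinP; apply: measurable_funM => //; exact: mf2.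
  + by move=> x _; rewrite lee_fin sqr_ge0.
  + by apply/measurable_EFinP; exact: mf2.
Qed.

End dqm_root.

Section iid_fubini.
Context d (T : measurableType d) (R : realType).
Implicit Type P : probability T R.

Lemma ge0_expectation_iidS P n (f : n.+1.-tuple T -> R) :
  measurable_fun setT f -> (forall x, 0 <= f x) ->
  ('E_(iid_law P n.+1)[f] =
   \int[P]_x 'E_(iid_law P n)[fun t => f (cons_pair (x, t))])%E.
Proof.
move=> mf f0; rewrite !unlock /=.
have mEf : measurable_fun setT (EFin \o f) by exact/measurable_EFinP.
rewrite ge0_integral_distribution//.
rewrite fubini_tonelli1//.
- apply: (measurableT_comp mEf); exact: measurable_cons_pair.
- by move=> z; rewrite lee_fin.
Qed.

Lemma measurable_expectation_iidS P n (f : n.+1.-tuple T -> R) :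
  measurable_fun setT f -> (forall x, 0 <= f x) ->
  measurable_fun setT
    (fun x => 'E_(iid_law P n)[fun t => f (cons_pair (x, t))])%E.
Proof.
move=> mf f0; under eq_fun do rewrite unlock.
apply: (@measurable_fun_fubini_tonelli_F _ _ _ _ _ _
  (fun z => (f (cons_pair z))%:E)) => //.
  by apply/measurable_EFinP; apply: (measurableT_comp mf); exact: measurable_cons_pair.
by move=> z; rewrite lee_fin.
Qed.

End iid_fubini.

(** * The one-observation step *)

Section one_step.
Context d (T : measurableType d) (R : realType).
Implicit Type P : probability T R.

Lemma ge0_integrable_le P (f : T -> R) (r : R) :
  measurable_fun setT f -> (forall x, 0 <= f x) ->
  (\int[P]_x (f x)%:E <= r%:E)%E ->
  P.-integrable setT (EFin \o f) /\ \int[P]_x f x <= r.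
Proof.
move=> mf f0 fr.
have fi : P.-integrable setT (EFin \o f).
  apply/integrableP; split; first exact/measurable_EFinP.
  under eq_integral do rewrite /= ger0_norm//.
  exact: le_lt_trans fr (ltry _).
split => //; rewrite -lee_fin fineK//.
exact: integrable_fin_num.
Qed.

(** Dominated convergence along integer truncation levels, with [f ^+ 2] as the dominating
    function. *)
Lemma truncated_second_moment P (f : T -> R) (I : R) :
  measurable_fun setT f -> (\int[P]_x (f x ^+ 2)%:E = I%:E)%E ->
  forall w : R, 0 < w -> exists2 M : R, 0 <= M &
    (\int[P]_x (f x ^+ 2 * \1_[set x | M < `|f x|] x)%:E <= w%:E)%E.
Proof.
move=> mf fI w w0.
have mf2 : measurable_fun setT (fun x => f x ^+ 2) by exact: measurable_funX.
have mset n : measurable [set x | n%:R < `|f x|].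
  rewrite -[X in measurable X]setTI.
  have -> : [set x | n%:R < `|f x|] = (fun x => `|f x|) @^-1` `]n%:R, +oo[.
    by apply/seteqP; split => x /=; rewrite in_itv/= andbT.
  by apply: (measurableT_comp (@normr_measurable R setT) mf) => //.
pose g n x : \bar R := (f x ^+ 2 * \1_[set x | n%:R < `|f x|] x)%:E.
have mg n : measurable_fun setT (g n).
  by apply/measurable_EFinP/measurable_funM => //; exact: measurable_indic.
have fi : P.-integrable setT (fun x => (f x ^+ 2)%:E).
  have [|//] := @ge0_integrable_le P (fun x => f x ^+ 2) I mf2 (fun x => sqr_ge0 _).
  by rewrite fI.
have gcvg : {ae P, forall x, setT x -> g n x @[n --> \oo] --> cst 0%E x}.
  apply: aeW => x _; apply: cvg_near_cst.
  near=> n.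
  have nf : ~ [set x | n%:R < `|f x|] x.
    by apply/negP; rewrite -leNgt; near: n; exact: nbhs_infty_ger.
  by rewrite /g indicE memNset ?mulr0.
have gle : {ae P, forall x, forall n, setT x -> (`|g n x| <= (f x ^+ 2)%:E)%E}.
  apply: aeW => x n _; rewrite /g abse_EFin lee_fin ger0_norm; last first.
    by apply: mulr_ge0; [exact: sqr_ge0|rewrite indicE].
  by rewrite ler_piMr ?sqr_ge0// indicE lern1 leq_b1.
have [_ _] := dominated_convergence measurableT mg (measurable_cst _) gcvg fi gle.
rewrite integral0 => /fine_cvgP[fing /cvgrPdist_lt/(_ w w0) gw].
have [n [gn gnw]] : exists n, (\int[P]_x g n x)%E \is a fin_num /\
    `|0 - fine (\int[P]_x g n x)%E| < w.
  by near \oo => n; exists n; split; near: n.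
exists n%:R => //; rewrite -(fineK gn) lee_fin.
by move: gnw; rewrite sub0r normrN => /ltW; apply: le_trans; exact: ler_norm.
Unshelve. all: by end_near. Qed.

Lemma integral_le1 P (f : T -> R) : measurable_fun setT f ->
  (forall x, 0 <= f x <= 1) -> (\int[P]_x (f x)%:E <= 1%:E)%E.
Proof.
move=> mf f01; rewrite -(@probability_setT _ _ _ P) -[leRHS]mul1e -integral_cst//.
apply: ge0_le_integral => //.
- by move=> x _; rewrite lee_fin; case/andP: (f01 x).
- exact/measurable_EFinP.
- by move=> x _; rewrite lee_fin; case/andP: (f01 x).
Qed.

Lemma integrable01 P (f : T -> R) : measurable_fun setT f ->
  (forall x, 0 <= f x <= 1) -> P.-integrable setT (EFin \o f).
Proof.
move=> mf f01; have f0 x : 0 <= f x by case/andP: (f01 x).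
by have [] := ge0_integrable_le mf f0 (integral_le1 P mf f01).
Qed.

(** Dropping the singular part of [Ph] can only lower the integral of a nonnegative function, the
    direction needed for lower bounds on risks. *)
Lemma dqm_root_integral_le P0 Ph (score root f : T -> R) (h c : R) :
  dqm_root P0 Ph score h c root ->
  measurable_fun setT f -> (forall x, 0 <= f x <= 1) ->
  P0.-integrable setT (EFin \o (fun x => f x * root x ^+ 2)) /\
  \int[P0]_x (f x * root x ^+ 2) <= \int[Ph]_x f x.
Proof.
move=> [mr _ rP _ _] mf f01; have f0 x : 0 <= f x by case/andP: (f01 x).
apply: ge0_integrable_le.
- by apply: measurable_funM => //; exact: measurable_funX.
- by move=> x; rewrite mulr_ge0 ?sqr_ge0.
rewrite fineK; first exact: rP.
by have /integrable_fin_num := integrable01 Ph mf f01; apply.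
Qed.

Lemma dqm_root_mass P0 Ph (score root : T -> R) (h c : R) :
  dqm_root P0 Ph score h c root ->
  [/\ P0.-integrable setT (EFin \o (fun x => root x ^+ 2)),
    \int[P0]_x (root x ^+ 2) <= 1 & 1 - c <= \int[P0]_x (root x ^+ 2)].
Proof.
move=> [mr _ rP _ rm].
have [fi fle] : P0.-integrable setT (EFin \o (fun x => root x ^+ 2)) /\
    \int[P0]_x (root x ^+ 2) <= 1.
  apply: ge0_integrable_le; [exact: measurable_funX|by move=> x; exact: sqr_ge0|].
  have := rP (cst 1) (measurable_cst _) (fun=> ler01).
  under eq_integral do rewrite mul1r.
  move=> /le_trans; apply; apply: integral_le1 => //.
  by move=> x; rewrite ler01 lexx.
split => //; rewrite lerBlDr -lee_fin EFinD fineK//.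
by have /integrable_fin_num := fi; apply.
Qed.

Lemma integrableZ_EFin P (k : R) (f : T -> R) : P.-integrable setT (EFin \o f) ->
  P.-integrable setT (EFin \o (fun x => k * f x)).
Proof.
move=> fi; rewrite (_ : _ \o _ = (fun x => k%:E * (f x)%:E)%E).
  exact: integrableZl.
by apply/funext => x; rewrite /= EFinM.
Qed.

Lemma integrableD_EFin P (f g : T -> R) : P.-integrable setT (EFin \o f) ->
  P.-integrable setT (EFin \o g) ->
  P.-integrable setT (EFin \o (fun x => f x + g x)).
Proof.
move=> fi gi; rewrite (_ : _ \o _ = ((EFin \o f) \+ (EFin \o g))%E).
  exact: integrableD.
by apply/funext => x; rewrite /= EFinD.
Qed.

(* [P1], [P2] are the laws of one observation and [K] is the error accumulated
   so far; [F], [G] are the conditional risks given the first observation. *)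
Definition one_step P1 P2 (s0 tau e : R) : Prop :=
  forall (s K u v : R) (F G : T -> R), s0 <= s -> 0 < u -> 0 < v -> 0 <= K ->
    measurable_fun setT F -> measurable_fun setT G ->
    (forall x, 0 <= F x <= 1) -> (forall x, 0 <= G x <= 1) ->
    (forall x (p q : R), 0 < p -> 0 < q ->
       gauss_risk s p q - K * (p + q) <= p * F x + q * G x) ->
  gauss_risk (Num.sqrt (s ^+ 2 + tau)) u v - (K + e) * (u + v) <=
    u * (\int[P1]_x F x) + v * (\int[P2]_x G x).

(** [local_risk_pointwise] is integrated under [P0]. The increment [4 * dl * I] equals
    [(h1 - h2) ^+ 2 * I]; the time step of this size lowers the risk by [tau / 2 * gauss_gamma s x]
    per unit of [v], which matches the second-order loss produced by the integration. *)
Lemma one_step_of_roots P0 P1 P2 (score : T -> R) (I h1 h2 c1 c2 : R)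
    (r1 r2 : T -> R) (s0 L C eta M w : R) :
  let dl := (2^-1 * h1 - 2^-1 * h2) ^+ 2 in
  measurable_fun setT score ->
  (\int[P0]_x (score x ^+ 2)%:E = I%:E)%E ->
  dqm_root P0 P1 score h1 c1 r1 -> dqm_root P0 P2 score h2 c2 r2 ->
  0 < s0 -> s0^-1 + s0 ^- 2 <= L -> s0 ^- 3 + s0^-1 <= C ->
  0 < eta <= 1 / 12 ->
  `|2^-1 * h1| * M <= eta / 16 -> `|2^-1 * h2| * M <= eta / 16 ->
  (\int[P0]_x (score x ^+ 2 * \1_[set x | M < `|score x|] x)%:E <= w%:E)%E ->
  one_step P1 P2 s0 (4 * dl * I)
    (c1 + c2 + 50 * L * eta * (dl * I)
     + (16 * L / eta + 24 / eta ^+ 2) * (dl * w + c1 + c2)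
     + C * (4 * dl * I) ^+ 2).
Proof.
move=> dl msc scI H1 H2 s0_gt0 hL hC.
have [mr1 r1_0 _ r1c _] := H1; have [mr2 r2_0 _ r2c _] := H2.
move=> heta h1M h2M hw s K u v F G s0s u0 v0 K0 mF mG F01 G01 HW.
have s_gt0 : 0 < s by exact: lt_le_trans s0s.
have is0 : s^-1 <= s0^-1 by rewrite lef_pV2 ?posrE.
have is2 : s ^- 2 <= s0 ^- 2.
  by rewrite lef_pV2 ?posrE ?exprn_gt0// lerXn2r// nnegrE ltW.
have is3 : s ^- 3 <= s0 ^- 3.
  by rewrite lef_pV2 ?posrE ?exprn_gt0// lerXn2r// nnegrE ltW.
have sL : s^-1 + s ^- 2 <= L by apply: le_trans hL; exact: lerD.
have sC : s ^- 3 + s^-1 <= C by apply: le_trans hC; exact: lerD.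
have L0 : 0 <= L.
  by apply: le_trans sL; rewrite addr_ge0// invr_ge0 ?sqr_ge0// ltW.
have I0 : 0 <= I.
  by rewrite -lee_fin -scI integral_ge0// => x _; rewrite lee_fin sqr_ge0.
have dl0 : 0 <= dl by exact: sqr_ge0.
have [eta0 _] := andP heta.
pose x := ln (u / v).
pose k := gauss_gamma s x.
have k0 : 0 <= k by exact: gauss_gamma_ge0.
pose A := ccdfn (s / 2 + x / s); pose B := ccdfn (s / 2 - x / s).
pose ind y : R := \1_[set x | M < `|score x|] y.
pose e1 y := r1 y - 1 - 2^-1 * h1 * score y.
pose e2 y := r2 y - 1 - 2^-1 * h2 * score y.
pose C2 := 16 * L / eta + 24 / eta ^+ 2.
have C20 : 0 <= C2.
  apply: addr_ge0; apply: divr_ge0; rewrite ?sqr_ge0 ?(ltW eta0)//.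
  exact: mulr_ge0.
pose f1 y := r1 y ^+ 2; pose f2 y := r2 y ^+ 2.
pose f3 y := F y * r1 y ^+ 2; pose f4 y := G y * r2 y ^+ 2.
pose f5 y := score y ^+ 2.
pose f6 y := f5 y * ind y.
pose f7 y := e1 y ^+ 2; pose f8 y := e2 y ^+ 2.
(* The pointwise bound is regrouped as a linear combination of eight functions, so that the integral
   splits termwise. *)
have pw y : 0 <= u * f3 y + (v * f4 y + ((K - A) * u * f1 y + ((K - B) * v * f2 y +
   ((v * (2 * k) * dl + (u + v) * (50 * L * eta) * dl) * f5 y +
    ((u + v) * C2 * dl * f6 y + ((u + v) * C2 * f7 y + (u + v) * C2 * f8 y)))))).
  have := @local_risk_pointwise R s L u v K (F y) (G y) eta M (2^-1 * h1) (2^-1 * h2)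
    (score y) (e1 y) (e2 y) (f6 y).
  have -> : 1 + 2^-1 * h1 * score y + e1 y = r1 y by rewrite /e1; ring.
  have -> : 1 + 2^-1 * h2 * score y + e2 y = r2 y by rewrite /e2; ring.
  move=> /(_ s_gt0 sL u0 v0 K0).
  have /andP[-> _] := F01 y; have /andP[-> _] := G01 y.
  move=> /(_ isT isT (HW y) heta (r1_0 y) (r2_0 y) h1M h2M) h.
  have f60 : 0 <= f6 y by rewrite mulr_ge0 ?sqr_ge0 ?/ind ?indicE.
  have {h} := h f60.
  rewrite -/x -/A -/B -/k -/dl -/C2 => h.
  have hi : M < `|score y| -> score y ^+ 2 <= f6 y.
    by move=> hM; rewrite /f6 /ind indicE mem_set// mulr1.
  have {h hi} := h hi.
  rewrite -/(f1 y) -/(f2 y) -/(f5 y) -/(f7 y) -/(f8 y).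
  have -> : u * f1 y * F y = u * f3 y by rewrite /f3 -/(f1 y); ring.
  have -> : v * f2 y * G y = v * f4 y by rewrite /f4 -/(f2 y); ring.
  lra.
have [i1 E1 E1'] := dqm_root_mass H1.
have [i2 E2 E2'] := dqm_root_mass H2.
have [i3 E3] := dqm_root_integral_le H1 mF F01.
have [i4 E4] := dqm_root_integral_le H2 mG G01.
have [|i5 E5] := @ge0_integrable_le P0 f5 I
    (measurable_funX _ msc) (fun y => sqr_ge0 _).
  by rewrite scI.
have mset : measurable [set y | M < `|score y|].
  rewrite -[X in measurable X]setTI.
  have -> : [set y | M < `|score y|] = (fun y => `|score y|) @^-1` `]M, +oo[.
    by apply/seteqP; split => y /=; rewrite in_itv/= andbT.
  by apply: (measurableT_comp (@normr_measurable R setT) msc) => //.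
have [||i6 E6] := @ge0_integrable_le P0 f6 w _ _ hw.
- by apply: measurable_funM; [exact: measurable_funX|exact: measurable_indic].
- by move=> y; rewrite mulr_ge0 ?sqr_ge0// /ind indicE.
have me1 : measurable_fun setT e1.
  by apply: measurable_funB; [exact: measurable_funB|exact: measurable_funM].
have me2 : measurable_fun setT e2.
  by apply: measurable_funB; [exact: measurable_funB|exact: measurable_funM].
have [i7 E7] := @ge0_integrable_le P0 f7 c1
    (measurable_funX _ me1) (fun y => sqr_ge0 _) r1c.
have [i8 E8] := @ge0_integrable_le P0 f8 c2
    (measurable_funX _ me2) (fun y => sqr_ge0 _) r2c.
have /= := @Rintegral_ge0 _ _ _ P0 setT _ (fun y _ => pw y).
do 7! (rewrite RintegralD; [|exact: measurableT
  |exact: integrableZ_EFin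
  |by do ?apply: integrableD_EFin; exact: integrableZ_EFin]).
do 8! (rewrite RintegralZl; [|exact: measurableT
  |first [exact: i1|exact: i2|exact: i3|exact: i4
    |exact: i5|exact: i6|exact: i7|exact: i8]]).
have E7_0 : 0 <= \int[P0]_y f7 y by apply: Rintegral_ge0 => y _; exact: sqr_ge0.
have E8_0 : 0 <= \int[P0]_y f8 y by apply: Rintegral_ge0 => y _; exact: sqr_ge0.
move: E1 E1' E2 E2' E3 E4 E5 E6 E7 E8 E7_0 E8_0.
rewrite -/f1 -/f2 -/f3 -/f4.
set X1 := \int[P0]_y f1 y; set X2 := \int[P0]_y f2 y.
set X3 := \int[P0]_y f3 y; set X4 := \int[P0]_y f4 y.
set X5 := \int[P0]_y f5 y; set X6 := \int[P0]_y f6 y.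
set X7 := \int[P0]_y f7 y; set X8 := \int[P0]_y f8 y.
set IF := \int[P1]_y F y; set IG := \int[P2]_y G y.
move=> E1 E1' E2 E2' E3 E4 E5 E6 E7 E8 E7_0 E8_0 main.
pose tau := 4 * dl * I.
have tau0 : 0 <= tau by apply: mulr_ge0 => //; exact: mulr_ge0.
have step : gauss_risk (Num.sqrt (s ^+ 2 + tau)) u v <=
    u * A + v * B - v * (2 * k) * dl * I + (u + v) * (C * tau ^+ 2).
  have h := ler_wpM2l (ltW v0) (gauss_risk1_timestep x s_gt0 tau0).
  apply: le_trans h _.
  have -> : v *
      (gauss_risk1 s x - tau / 2 * gauss_gamma s x + (s ^- 3 + s^-1) * tau ^+ 2) =
     v * expR x * A + v * B - v * (2 * k) * dl * I
     + v * ((s ^- 3 + s^-1) * tau ^+ 2).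
    by rewrite /gauss_risk1 /tau -/A -/B -/k; field; rewrite gt_eqF.
  have -> : v * expR x = u.
    by rewrite /x lnK ?posrE ?divr_gt0// mulrC divfK// gt_eqF.
  have t2 : 0 <= tau ^+ 2 by exact: sqr_ge0.
  have hv : v * ((s ^- 3 + s^-1) * tau ^+ 2) <= v * (C * tau ^+ 2).
    by rewrite ler_wpM2l ?(ltW v0)// ler_wpM2r.
  have C0 : 0 <= C * tau ^+ 2.
    apply: mulr_ge0 => //; apply: le_trans sC.
    by rewrite addr_ge0// invr_ge0 ?exprn_ge0// ltW.
  have := mulr_ge0 (ltW u0) C0.
  lra.
have A1 : A <= 1 by exact: ccdfn_le1.
have A0 : 0 <= A by exact: ccdfn_ge0.
have B1 : B <= 1 by exact: ccdfn_le1.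
have B0 : 0 <= B by exact: ccdfn_ge0.
have c10 : 0 <= c1 by exact: le_trans E7.
have c20 : 0 <= c2 by exact: le_trans E8.
have m3 : u * X3 <= u * IF by rewrite ler_wpM2l ?(ltW u0).
have m4 : v * X4 <= v * IG by rewrite ler_wpM2l ?(ltW v0).
have Ku : 0 <= K * u by rewrite mulr_ge0 ?(ltW u0).
have Kv : 0 <= K * v by rewrite mulr_ge0 ?(ltW v0).
(* The masses of [r1 ^+ 2] and [r2 ^+ 2] are at most 1, used against [K], and at least [1 - c1] and
   [1 - c2], used against [A] and [B]; the lost singular mass enters the error as [c1 + c2]. *)
have m1 : K * u * X1 <= K * u by rewrite ler_piMr.
have m2 : K * v * X2 <= K * v by rewrite ler_piMr.
have Au : A * u - c1 * u <= A * u * X1.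
  have q1 : A * u * (1 - c1) <= A * u * X1 by rewrite ler_wpM2l// mulr_ge0 ?(ltW u0).
  have q2 : A * (u * c1) <= u * c1 by rewrite ler_piMl// mulr_ge0// ltW.
  lra.
have Bv : B * v - c2 * v <= B * v * X2.
  have q1 : B * v * (1 - c2) <= B * v * X2 by rewrite ler_wpM2l// mulr_ge0 ?(ltW v0).
  have q2 : B * (v * c2) <= v * c2 by rewrite ler_piMl// mulr_ge0// ltW.
  lra.
have uv0 : 0 <= u + v by rewrite addr_ge0 ?ltW.
have m5 : (v * (2 * k) * dl + (u + v) * (50 * L * eta) * dl) * X5 <=
    (v * (2 * k) * dl + (u + v) * (50 * L * eta) * dl) * I.
  rewrite ler_wpM2l//.
  have := mulr_ge0 (mulr_ge0 (ltW v0) k0) dl0.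
  have := mulr_ge0 (mulr_ge0 uv0 (mulr_ge0 L0 (ltW eta0))) dl0.
  lra.
have uvC : 0 <= (u + v) * C2 by exact: mulr_ge0.
have m6 : (u + v) * C2 * dl * X6 <= (u + v) * C2 * dl * w.
  by rewrite ler_wpM2l// mulr_ge0.
have m7 : (u + v) * C2 * X7 <= (u + v) * C2 * c1 by rewrite ler_wpM2l.
have m8 : (u + v) * C2 * X8 <= (u + v) * C2 * c2 by rewrite ler_wpM2l.
have := mulr_ge0 (ltW u0) c20; have := mulr_ge0 (ltW v0) c10.
rewrite -/C2 -/tau.
lra.
Qed.

End one_step.

(** * Iteration and conclusion *)

Section iteration.
Context d (T : measurableType d) (R : realType).
Implicit Type P : probability T R.

Lemma one_step_le P1 P2 (s0 tau e e' : R) : e <= e' ->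
  one_step P1 P2 s0 tau e -> one_step P1 P2 s0 tau e'.
Proof.
move=> ee' H s K u v F G s0s u0 v0 K0 mF mG F01 G01 HW.
apply: le_trans (H s K u v F G s0s u0 v0 K0 mF mG F01 G01 HW).
by rewrite lerD2l lerN2 ler_wpM2r ?lerD2l// addr_ge0 ?ltW.
Qed.

Lemma fine_expectation01 d' (T' : measurableType d') (Q : probability T' R)
    (f : T' -> R) : measurable_fun setT f -> (forall x, 0 <= f x <= 1) ->
  [/\ 'E_Q[f]%E \is a fin_num, 0 <= fine 'E_Q[f] & fine 'E_Q[f] <= 1].
Proof.
move=> mf f01; rewrite unlock.
have f0 x : 0 <= f x by case/andP: (f01 x).
have [fi f1] := ge0_integrable_le mf f0 (integral_le1 Q mf f01).
split => //; first by have /integrable_fin_num := fi; apply.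
by apply: fine_ge0; apply: integral_ge0 => x _; rewrite lee_fin.
Qed.

Lemma fine_expectation_iidS P n (f : n.+1.-tuple T -> R) :
  measurable_fun setT f -> (forall x, 0 <= f x <= 1) ->
  let F x := fine ('E_(iid_law P n)[fun t => f (cons_pair (x, t))])%E in
  [/\ measurable_fun setT F, forall x, 0 <= F x <= 1 &
      fine 'E_(iid_law P n.+1)[f] = \int[P]_x F x].
Proof.
move=> mf f01 F.
have f0 x : 0 <= f x by case/andP: (f01 x).
have mfx x : measurable_fun setT (fun t : n.-tuple T => f (cons_pair (x, t))).
  apply: (measurableT_comp mf).
  by apply: measurableT_comp; [exact: measurable_cons_pair|exact: pair1_measurable].
have Fx x := fine_expectation01 (iid_law P n) (mfx x) (fun t => f01 _).
split.
- apply: (measurableT_comp (@fine_measurable R setT measurableT)) => //.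
  exact: measurable_expectation_iidS.
- by move=> x; have [_ -> ->] := Fx x.
- rewrite ge0_expectation_iidS//; congr fine.
  by apply: eq_integral => x _; rewrite fineK//; have [] := Fx x.
Qed.

(** Each observation adds [tau] to the square of the shift and [e] to the error coefficient. The
    weights stay general because the step uses the induction hypothesis at all positive [p] and
    [q]. *)
Lemma one_step_iter P1 P2 (s0 tau e : R) n (f : n.-tuple T -> R) (u v : R) :
  one_step P1 P2 s0 tau e -> 0 < s0 -> 0 <= tau -> 0 <= e ->
  measurable_fun setT f -> (forall x, 0 <= f x <= 1) -> 0 < u -> 0 < v ->
  gauss_risk (Num.sqrt (s0 ^+ 2 + n%:R * tau)) u v - n%:R * e * (u + v) <=
  u * fine 'E_(iid_law P1 n)[f] + v * fine 'E_(iid_law P2 n)[fun x => 1 - f x].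
Proof.
move=> H s0_gt0 tau0 e0; elim: n f u v => [|n IHn] f u v mf f01 u0 v0.
  (* Without observations the risk is a convex combination of [u] and [v] with coefficient [f
     [tuple]]. *)
  rewrite !unlock !integral_dirac//; last 2 first.
  - by apply/measurable_EFinP; exact: measurable_funB.
  - exact/measurable_EFinP.
  rewrite !diracT !mul1e /= !mul0r addr0 subr0 sqrtr_sqr (gtr0_norm s0_gt0).
  have /andP[fl fr] := f01 [tuple].
  have := gauss_risk_le_min s0_gt0 u0 v0; rewrite le_min => /andP[hu hv].
  have := ler_wpM2r fl hu.
  have : 0 <= 1 - f [tuple] by rewrite subr_ge0.
  move=> /ler_wpM2r/(_ _ _ hv); lra.
have f01' x : 0 <= 1 - f x <= 1.
  by have /andP[fl fr] := f01 x; apply/andP; split; lra.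
have mf' : measurable_fun setT (fun x => 1 - f x) by exact: measurable_funB.
have [mF F01 ->] := fine_expectation_iidS P1 mf f01.
have [mG G01 ->] := fine_expectation_iidS P2 mf' f01'.
have s2 : 0 <= s0 ^+ 2 + n%:R * tau by rewrite addr_ge0 ?sqr_ge0// mulr_ge0.
have := H (Num.sqrt (s0 ^+ 2 + n%:R * tau)) (n%:R * e) u v
  _ _ _ u0 v0 _ mF mG F01 G01 _.
have -> : Num.sqrt (s0 ^+ 2 + n%:R * tau) ^+ 2 + tau = s0 ^+ 2 + n.+1%:R * tau.
  by rewrite sqr_sqrtr// -natr1; ring.
have -> : n%:R * e + e = n.+1%:R * e by rewrite -natr1; ring.
apply.
- rewrite -[leLHS](gtr0_norm s0_gt0) -sqrtr_sqr ler_wsqrtr// lerDl.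
  exact: mulr_ge0.
- exact: mulr_ge0.
- move=> x p q p0 q0; apply: IHn => //.
  apply: (measurableT_comp mf).
  by apply: measurableT_comp; [exact: measurable_cons_pair|exact: pair1_measurable].
Qed.

(** The error of [one_step_of_roots] splits into four parts, each made at most [e / 5 * D ^+ 2]. The
    order of choice matters: [eta] first, then [w] and [c], since [C2] grows as [eta] shrinks, then
    the truncation level [M] from [w], and last the radius [r]. *)
Lemma one_step_near0 (Theta : set R) (P : R -> probability T R) (score : T -> R)
    (I eps s0 e : R) : nbhs (0 : R) Theta -> dqm_at0 Theta P score ->
  fisher_information (P 0) score = I%:E -> 0 < eps < 1 -> 0 < s0 -> 0 < e ->
  exists2 r : R, 0 < r & forall D, 0 < D < r ->
    [/\ Theta ((1 - eps) * D), Theta ((1 + eps) * D) &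
    one_step (P ((1 - eps) * D)) (P ((1 + eps) * D)) s0
      (4 * (eps * D) ^+ 2 * I) (e * D ^+ 2)].
Proof.
move=> hTheta [msc [mu [p0 [p [dens dqm]]]]] scI /andP[eps0 eps1] s0_gt0 e_gt0.
rewrite /fisher_information unlock in scI.
have I0 : 0 <= I.
  by rewrite -lee_fin -scI integral_ge0// => x _; rewrite lee_fin sqr_ge0.
pose L := s0^-1 + s0 ^- 2; pose C := s0 ^- 3 + s0^-1.
have L0 : 0 <= L by rewrite addr_ge0 ?invr_ge0 ?exprn_ge0 ?(ltW s0_gt0).
have C0 : 0 <= C by rewrite addr_ge0 ?invr_ge0 ?exprn_ge0 ?(ltW s0_gt0).
pose a1 := 50 * L * eps ^+ 2 * I.
have a10 : 0 <= a1 by rewrite !mulr_ge0 ?(ltW eps0).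
pose eta := Num.min (1 / 12) (e / 5 / (a1 + 1)).
have eta0 : 0 < eta.
  by rewrite lt_min; apply/andP; split; rewrite ?divr_gt0 ?ltr_wpDl.
have eta12 : 0 < eta <= 1 / 12 by rewrite eta0 ge_min lexx.
have etae : a1 * eta <= e / 5.
  have : eta * (a1 + 1) <= e / 5.
    by rewrite -ler_pdivlMr ?ltr_wpDl// ge_min lexx orbT.
  by lra.
pose C2 := 16 * L / eta + 24 / eta ^+ 2.
have C20 : 0 <= C2.
  apply: addr_ge0; apply: divr_ge0; rewrite ?sqr_ge0 ?(ltW eta0)//.
  exact: mulr_ge0.
pose w := e / 5 / (C2 * eps ^+ 2 + 1).
have a20 : 0 <= C2 * eps ^+ 2 by rewrite mulr_ge0 ?sqr_ge0.
have w0 : 0 < w by rewrite !divr_gt0// ltr_wpDl.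
have we : C2 * eps ^+ 2 * w <= e / 5.
  have : (C2 * eps ^+ 2 + 1) * w = e / 5.
    by rewrite mulrC divfK// gt_eqF// ltr_wpDl.
  by lra.
(* Both parameters are at most [2 * D], so [k1 + k2 <= 8 * c * D ^+ 2], and this sum occurs with the
   factor [1 + C2]; hence the 40. *)
pose c := e / 40 / (1 + C2).
have c0 : 0 < c by rewrite !divr_gt0// ltr_pwDl.
have ce : (1 + C2) * (8 * c) = e / 5.
  by rewrite /c; field; rewrite gt_eqF// ltr_pwDl.
pose a3 := C * (4 * eps ^+ 2 * I) ^+ 2.
have a30 : 0 <= a3 by rewrite mulr_ge0 ?sqr_ge0.
have [M M0 hM] := truncated_second_moment msc scI w0.
have [r1 r10 hr1] : exists2 r1 : R, 0 < r1 & forall h, `|h| < r1 -> Theta h.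
  have /nbhs_ballP[r1 /= r10 hr1] := hTheta; exists r1 => // h hr.
  by apply: hr1; rewrite /ball/= sub0r normrN.
have [r2 r20 hr2] : exists2 r2 : R, 0 < r2 & forall h, `|h| < r2 -> Theta h ->
    (\int[mu h]_x ((Num.sqrt (p h x) - Num.sqrt (p0 h x)
          - 2^-1 * h * score x * Num.sqrt (p0 h x)) ^+ 2)%:E
        <= (c * h ^+ 2)%:E)%E.
  have /nbhs_ballP[r2 /= r20 hr2] := dqm c c0; exists r2 => // h hr.
  by apply: hr2; rewrite /ball/= sub0r normrN.
(* The halves account for parameters up to [2 * D]; the bound 1 gives [D ^+ 2 <= D], which with the
   next entry handles the term of order four in [D]; the last entry keeps [D * M] small compared
   with [eta]. *)
pose r := Num.min (Num.min (r1 / 2) (r2 / 2))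
  (Num.min 1 (Num.min (e / 5 / (a3 + 1)) (eta / 16 / (M + 1)))).
exists r.
  rewrite !lt_min ltr01 !divr_gt0//=; first by rewrite ltr_wpDl.
  by rewrite ltr_wpDl.
move=> D /andP[D0]; rewrite !lt_min => /andP[/andP[Dr1 Dr2] /and3P[D1 D3 DM]].
have root h : `|h| < r1 -> `|h| < r2 ->
    Theta h /\ exists root, dqm_root (P 0) (P h) score h (c * h ^+ 2) root.
  move=> h1 h2; have Th := hr1 _ h1; split => //.
  have [d0 d1] := dens h Th.
  exact: dqm_root_of_density msc d0 d1 (hr2 _ h2 Th).
pose h1 := (1 - eps) * D; pose h2 := (1 + eps) * D.
have eD : 0 < eps * D by rewrite mulr_gt0.
have eD' : eps * D < D by rewrite -[ltRHS]mul1r ltr_pM2r.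
have h1D : `|h1| <= 2 * D by rewrite ger0_norm /h1; lra.
have h2D : `|h2| <= 2 * D by rewrite ger0_norm /h2; lra.
have [Th1 [q1 Q1]] : Theta h1 /\
    exists root, dqm_root (P 0) (P h1) score h1 (c * h1 ^+ 2) root.
  by apply: root; lra.
have [Th2 [q2 Q2]] : Theta h2 /\
    exists root, dqm_root (P 0) (P h2) score h2 (c * h2 ^+ 2) root.
  by apply: root; lra.
split => //.
have dM : D * (M + 1) < eta / 16 by rewrite -ltr_pdivlMr// ltr_wpDl.
have hDM h : `|h| <= 2 * D -> `|2^-1 * h| * M <= eta / 16.
  move=> hD; rewrite normrM ger0_norm//.
  have : `|h| * M <= 2 * D * M by rewrite ler_wpM2r.
  lra.
have := one_step_of_roots msc scI Q1 Q2 s0_gt0 (lexx L) (lexx C) eta12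
  (hDM _ h1D) (hDM _ h2D) hM.
have -> : (2^-1 * h1 - 2^-1 * h2) ^+ 2 = (eps * D) ^+ 2 by rewrite /h1 /h2; field.
apply: one_step_le.
have sq h : `|h| <= 2 * D -> c * h ^+ 2 <= c * (4 * D ^+ 2).
  move=> hD; rewrite ler_wpM2l ?(ltW c0)// -[h ^+ 2]real_normK ?num_real//.
  have -> : 4 * D ^+ 2 = (2 * D) ^+ 2 by ring.
  by rewrite lerXn2r ?nnegrE// mulr_ge0// ltW.
have := sq _ h1D; have := sq _ h2D.
set k1 := c * h1 ^+ 2; set k2 := c * h2 ^+ 2 => hk2 hk1.
rewrite -/C2.
have D2 : 0 <= D ^+ 2 by exact: sqr_ge0.
have t1 : 50 * L * eta * ((eps * D) ^+ 2 * I) <= e / 5 * D ^+ 2.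
  by have := ler_wpM2r D2 etae; rewrite /a1; lra.
have t2 : C2 * ((eps * D) ^+ 2 * w) <= e / 5 * D ^+ 2.
  by have := ler_wpM2r D2 we; lra.
have t3 : (1 + C2) * (k1 + k2) <= e / 5 * D ^+ 2.
  rewrite -ce.
  have : (1 + C2) * (k1 + k2) <= (1 + C2) * (8 * c * D ^+ 2).
    by apply: ler_wpM2l; [exact: addr_ge0|lra].
  lra.
have t4 : C * (4 * (eps * D) ^+ 2 * I) ^+ 2 <= e / 5 * D ^+ 2.
  have -> : C * (4 * (eps * D) ^+ 2 * I) ^+ 2 = a3 * D ^+ 2 * D ^+ 2.
    by rewrite /a3; ring.
  rewrite ler_wpM2r//.
  have : D * (a3 + 1) < e / 5 by rewrite -ltr_pdivlMr// ltr_wpDl.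
  have : D ^+ 2 <= D by rewrite expr2 ler_piMr// ltW.
  move=> /(ler_wpM2l a30); lra.
have := mulr_ge0 (ltW e_gt0) D2.
lra.
Qed.

End iteration.

(** * Reduction to two points and passage to the limit *)

Lemma gauss_risk11 (R : realType) (s : R) : gauss_risk s 1 1 = 2 * ccdfn (s / 2).
Proof. by rewrite /gauss_risk /gauss_risk1 divr1 ln1 mul0r addr0 subr0 expR0; ring. Qed.

Lemma ccdfn_shift (R : realType) (x y : R) : 0 <= y -> ccdfn x - y <= ccdfn (x + y).
Proof.
move=> y0.
have [t _] := @MVT_line R ccdfn (fun x => - phi x) x (x + y)
  (fun t _ => is_derive_ccdfn _).
rewrite [x + y - x]addrAC subrr add0r => E.
have : phi (x + t * y) * y <= y by rewrite ler_piMl// phi_le1.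
lra.
Qed.

Lemma ccdfn_nincr (R : realType) (x y : R) : x <= y -> ccdfn y <= ccdfn x.
Proof.
move=> xy.
have [t _] := @MVT_line R ccdfn (fun x => - phi x) x y
  (fun t _ => is_derive_ccdfn _).
rewrite -subr_le0 => ->; rewrite mulNr oppr_le0 mulr_ge0 ?phi_ge0//.
by rewrite subr_ge0.
Qed.

Lemma limn_einf_ge (R : realType) (u : nat -> \bar R) (l : \bar R) :
  (\forall n \near \oo, (l <= u n)%E) -> (l <= limn_einf u)%E.
Proof.
move=> [N _ Nu]; rewrite -[limn_einf u]/(limf_einf u \oo) limf_einfE.
apply: le_ereal_sup_tmp; exists (ereal_inf (u @` [set n | (N <= n)%N])).
  by exists [set n | (N <= n)%N] => //; exists N.
by apply: le_ereal_inf_tmp => _ [n Nn <-]; exact: Nu.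
Qed.

(** Each supremum is at least its value at one parameter, which leaves a test between two simple
    hypotheses. *)
Lemma minimax_risk_two_points (R : realType) (d : measure_display)
    (T : measurableType d) (Theta : set R) (P : R -> probability T R)
    (n : nat) (D eps t1 t2 : R) (b : R) :
  Defs.null_set Theta D eps t1 -> Defs.alt_set Theta D eps t2 ->
  (forall f : n.-tuple T -> R, measurable_fun setT f -> (forall x, 0 <= f x <= 1) ->
    b <= fine 'E_(iid_law (P t1) n)[f]
      + fine 'E_(iid_law (P t2) n)[fun x => 1 - f x]) ->
  (b%:E <= minimax_risk Theta P n D eps)%E.
Proof.
move=> h1 h2 hb; apply: le_ereal_inf_tmp => _ [f [mf f01] <-].
have f01' x : 0 <= 1 - f x <= 1.
  by have /andP[fl fr] := f01 x; apply/andP; split; lra.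
have mf' : measurable_fun setT (fun x => 1 - f x) by exact: measurable_funB.
have [n1 _ _] := fine_expectation01 (iid_law (P t1) n) mf f01.
have [n2 _ _] := fine_expectation01 (iid_law (P t2) n) mf' f01'.
apply: (@le_trans _ _ ('E_(iid_law (P t1) n)[f]
    + 'E_(iid_law (P t2) n)[fun x => (1 - f x)%R])%E).
  by rewrite -(fineK n1) -(fineK n2) -EFinD lee_fin; exact: hb.
by apply: leeD; apply: ereal_sup_ubound; [exists t1|exists t2].
Qed.

Theorem theorem1 (R : realType) (d : measure_display) (T : measurableType d)
    (Theta : set R) (hTheta : nbhs (0 : R) Theta)
    (P : R -> probability T R)
    (score : T -> R) (hdqm : dqm_at0 Theta P score)
    (I0 : R) (hI0 : fisher_information (P 0) score = I0%:E) (I0_gt0 : 0 < I0)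
    (Delta : nat -> R) (Delta_gt0 : forall n, 0 < Delta n)
    (kappa : R) (kappa_ge0 : 0 <= kappa)
    (hlambda : (fun n : nat => Num.sqrt (n%:R * I0) * Delta n) @ \oo --> kappa)
    (eps : R) (eps_gt0 : 0 < eps) (eps_lt1 : eps < 1) :
  ((2 * (1 - Phi (eps * kappa)))%:E
    <= limn_einf (fun n => minimax_risk Theta P n (Delta n) eps))%E.
Proof.
apply/lee_addgt0Pr => dlt dlt0; rewrite -leeBlDr// -EFinB.
apply: limn_einf_ge.
(* The total loss allowed is [dlt]: one half is [2 * s0], from the initial shift, and the other is
   the accumulated error, [dlt / 4] for each of the two unit weights. *)
pose s0 := dlt / 4.
have s0_gt0 : 0 < s0 by rewrite divr_gt0.
(* Since [lam ^+ 2 = n%:R * I0 * D ^+ 2] and eventually [lam <= kappa + 1], [B] bounds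
   [n%:R * D ^+ 2]; the accumulated error per unit weight is then at most [e * B = dlt / 4]. *)
pose B := (kappa + 1) ^+ 2 / I0.
have B0 : 0 < B by rewrite divr_gt0// exprn_gt0// ltr_wpDl.
pose e := dlt / 4 / B.
have e0 : 0 < e by apply: divr_gt0 => //; exact: divr_gt0.
have eps01 : 0 < eps < 1 by rewrite eps_gt0.
have [r r0 hr] := one_step_near0 hTheta hdqm hI0 eps01 s0_gt0 e0.
have m0 : 0 < Num.min (s0 / 2) 1 by rewrite lt_min ltr01 divr_gt0.
move/cvgrPdist_lt : hlambda => /(_ _ m0) hl.
near=> n.
have : `|kappa - Num.sqrt (n%:R * I0) * Delta n| < Num.min (s0 / 2) 1.
  by near: n; exact: hl.
set D := Delta n; set lam := Num.sqrt _ * D; rewrite lt_min => /andP[l1 l2].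
have D0 : 0 < D by exact: Delta_gt0.
(* Together with [n%:R * D ^+ 2 <= B] this forces [D < r]; the added 1 makes the inequality strict
   and [n] positive. *)
have nbig : B / r ^+ 2 + 1 <= n%:R by near: n; exact: nbhs_infty_ger.
have n0 : 0 < n%:R :> R.
  by apply: lt_le_trans nbig; rewrite ltr_pwDr// divr_ge0 ?sqr_ge0// ltW.
have lam0 : 0 <= lam by rewrite mulr_ge0 ?sqrtr_ge0// ltW.
have lam2 : lam ^+ 2 = n%:R * I0 * D ^+ 2.
  by rewrite exprMn sqr_sqrtr// mulr_ge0 ?ltW.
have lamk1 : lam <= kappa + 1.
  by move: l2; rewrite ltr_norml => /andP[]; lra.
have lamks : lam <= kappa + s0 / 2.
  by move: l1; rewrite ltr_norml => /andP[]; lra.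
have nD2 : n%:R * D ^+ 2 <= B.
  rewrite /B ler_pdivlMr//.
  have -> : n%:R * D ^+ 2 * I0 = lam ^+ 2 by rewrite lam2; ring.
  by rewrite lerXn2r ?nnegrE// addr_ge0.
have Dr : D < r.
  rewrite -(@ltr_pXn2r _ 2) ?nnegrE ?ltW// -(ltr_pM2l n0).
  apply: le_lt_trans nD2 _; rewrite -ltr_pdivrMr ?exprn_gt0//.
  by apply: lt_le_trans nbig; rewrite ltrDl.
have [Th1 Th2 step] : [/\ Theta ((1 - eps) * D), Theta ((1 + eps) * D) &
    one_step (P ((1 - eps) * D)) (P ((1 + eps) * D)) s0
      (4 * (eps * D) ^+ 2 * I0) (e * D ^+ 2)].
  by apply: hr; rewrite D0.
apply: (@minimax_risk_two_points _ _ _ _ _ _ _ _ ((1 - eps) * D) ((1 + eps) * D)).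
- by split => //=; rewrite ger0_norm// mulr_ge0 ?subr_ge0 ?ltW.
- by split => //=; rewrite ger0_norm// mulr_ge0 ?addr_ge0 ?ltW.
move=> f mf f01.
have tau0 : 0 <= 4 * (eps * D) ^+ 2 * I0.
  by apply: mulr_ge0; rewrite ?(ltW I0_gt0)// mulr_ge0 ?sqr_ge0.
have eD0 : 0 <= e * D ^+ 2 by rewrite mulr_ge0 ?sqr_ge0// ltW.
have := one_step_iter step s0_gt0 tau0 eD0 mf f01 ltr01 ltr01.
rewrite !mul1r gauss_risk11; apply: le_trans.
set sn := Num.sqrt _.
have ek0 : 0 <= eps * kappa by rewrite mulr_ge0// ltW.
(* Here [sn ^+ 2 = s0 ^+ 2 + 4 * (eps * lam) ^+ 2]; the margin [s0] covers both the initial shift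
   and the excess of [lam] over [kappa], at most [s0 / 2]. *)
have sn2 : sn / 2 <= eps * kappa + s0.
  rewrite ler_pdivrMr//.
  rewrite -(@ler_pXn2r _ 2) ?nnegrE ?sqrtr_ge0//; last first.
    by rewrite mulr_ge0// addr_ge0// ltW.
  rewrite sqr_sqrtr; last by rewrite addr_ge0 ?sqr_ge0// mulr_ge0.
  have -> : s0 ^+ 2 + n%:R * (4 * (eps * D) ^+ 2 * I0) =
      s0 ^+ 2 + 4 * (eps * lam) ^+ 2.
    by rewrite [(eps * lam) ^+ 2]exprMn lam2; ring.
  have el : eps * lam <= eps * kappa + s0 / 2.
    have h1 : eps * lam <= eps * (kappa + s0 / 2) by rewrite ler_wpM2l// ltW.
    have h2 : eps * s0 <= s0 by rewrite ler_piMl// ltW.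
    lra.
  have : (eps * lam) ^+ 2 <= (eps * kappa + s0 / 2) ^+ 2.
    by rewrite lerXn2r ?nnegrE ?addr_ge0 ?mulr_ge0// ltW.
  have := mulr_ge0 ek0 (ltW s0_gt0); have := sqr_ge0 s0.
  nra.
have h1 : ccdfn (eps * kappa + s0) <= ccdfn (sn / 2) by exact: ccdfn_nincr.
have h2 := ccdfn_shift (eps * kappa) (ltW s0_gt0).
have h3 : e * (n%:R * D ^+ 2) <= dlt / 4.
  have -> : dlt / 4 = e * B by rewrite /e divfK// gt_eqF.
  by rewrite ler_wpM2l// ltW.
rewrite -/(ccdfn _); rewrite /s0 in h2; lra.
Unshelve. all: by end_near. Qed.
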